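(* 1. Let $T(z)=\sum_{N\ge0}a_Nz^N$ be a Taylor series such that $\limsup_{N\to+\infty}|a_N|^{1/N}=B<+\infty$. Then the series $$S=\sum_{N\ge0}a_N\big(-(-x_1)^+\big)^{\sqcup\!\sqcup\, N}$$ is summable in $\mathbb{C}\langle\!\langle X\rangle\!\rangle$ (with sum in $\mathbb{C}\langle\!\langle x_1\rangle\!\rangle$), $S\in\mathrm{Dom}_R(\mathrm{Li})$ with $R=(B+1)^{-1}$, and $\mathrm{Li}_S=T$. 2. Let $S\in\mathrm{Dom}_R(\mathrm{Li})$ (where $0<R\le1$), with homogeneous decomposition $S=\sum_{n\ge0}[S]_n$, and define $N\mapsto\mathrm{H}_{\pi_Y(S)}(N)$ by $$\frac{\mathrm{Li}_S(z)}{1-z}=\sum_{N\ge0}\mathrm{H}_{\pi_Y(S)}(N)z^N .$$ 3. Moreover (with $S$ as in point 2), $$\forall r\in\,]0,R[,\qquad \sum_{n,N\ge0}\big|\mathrm{H}_{\pi_Y([S]_n)}(N)\,r^N\big|<+\infty,$$ and, for all $N\in\mathbb{N}$, the series of complex numbers $\sum_{n\ge0}\mathrm{H}_{\pi_Y([S]_n)}(N)$ converges absolutely to $\mathrm{H}_{\pi_Y(S)}(N)$. 4. Conversely, let $Q\in\mathbb{C}\langle\!\langle Y\rangle\!\rangle$ with $Q=\sum_{n\ge0}Q_n$ (decomposition by weights), and suppose there exists $r\in\,]0,1]$ such that $$\sum_{n,N\ge0}\big|\mathrm{H}_{Q_n}(N)\,r^N\big|<+\infty;$$ in particular, for all $N\in\mathbb{N}$,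 $\sum_{n\ge0}\mathrm{H}_{Q_n}(N)=\ell(N)\in\mathbb{C}$ unconditionally. Then $\pi_X(Q)\in\mathrm{Dom}_r(\mathrm{Li})$ and, for all $z\in\mathbb{C}$ with $|z|\le r$ and $z\ne1$, $$\frac{\mathrm{Li}_{\pi_X(Q)}(z)}{1-z}=\sum_{N\ge0}\ell(N)z^N .$$
   Context: Let $X=\{x_0,x_1\}$, $Y=\{y_n\}_{n\ge1}$, with free monoids $X^*,Y^*$; $\mathbb{C}\langle\!\langle X\rangle\!\rangle$, $\mathbb{C}\langle\!\langle Y\rangle\!\rangle$ are the spaces of noncommutative series; $\langle S\mid w\rangle$ is the coefficient of $w$ in $S$. For $S\in\mathbb{C}\langle\!\langle X\rangle\!\rangle$, $[S]_n=\sum_{|w|=n}\langle S\mid w\rangle w$ with $|w|$ the length. The weight of $y_{s_1}\cdots y_{s_r}\in Y^*$ is $s_1+\cdots+s_r$, and $Q_n$ is the part of $Q$ supported on words of weight $n$ (a polynomial). $\mathbb{C}\langle\!\langle X\rangle\!\rangle x_1\oplus\mathbb{C}1_{X^*}$ is the set of series supported on words ending in $x_1$ together with the empty word. The shuffle product $\sqcup\!\sqcup$ is defined by $u\sqcup\!\sqcup 1_{X^*}=1_{X^*}\sqcup\!\sqcup u=u$, $au\sqcup\!\sqcup bv=a(u\sqcup\!\sqcup bv)+b(au\sqcup\!\sqcup v)$ (letters $a,b$, words $u,v$), extended to series. $(-x_1)^+=\sum_{n\ge1}(-x_1)^n$ (concatenation powers). A family of series is summable in $\mathbb{C}\langle\!\langle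 X\rangle\!\rangle$ if each word has nonzero coefficient in only finitely many members. For $w=x_0^{s_1-1}x_1\cdots x_0^{s_r-1}x_1$ ($r,s_i\ge1$) and $|z|<1$, $\mathrm{Li}_w(z)=\sum_{n_1>\cdots>n_r>0}\frac{z^{n_1}}{n_1^{s_1}\cdots n_r^{s_r}}$; $\mathrm{Li}_{1_{X^*}}=1$. For $w=y_{s_1}\cdots y_{s_r}$, $\mathrm{H}_w(N)=\sum_{N\ge n_1>\cdots>n_r>0}\frac{1}{n_1^{s_1}\cdots n_r^{s_r}}$; $\mathrm{H}_{1_{Y^*}}(N)=1$. Both are extended linearly to polynomials. $\pi_Y:\mathbb{C}\langle\!\langle X\rangle\!\rangle x_1\oplus\mathbb{C}1_{X^*}\to\mathbb{C}\langle\!\langle Y\rangle\!\rangle$ is the linear bijection (acting word by word on series) sending $x_0^{s_1-1}x_1\cdots x_0^{s_r-1}x_1\mapsto y_{s_1}\cdots y_{s_r}$, $1_{X^*}\mapsto1_{Y^*}$, and $\pi_X$ is its inverse. $D_{<R}=\{|z|<R\}$; $\mathcal{H}(D_{<R})$ is the space of holomorphic functions on it with the topology of uniform convergence on compact sets (unconditional convergence of $\sum f_n$ being equivalent to $\sum_n\sup_K|f_n|<+\infty$ for every compact $K$). For $0<R\le1$, $\mathrm{Dom}_R(\mathrm{Li})$ is the set of $S\in\mathbb{C}\langle\!\langle X\rangle\!\rangle x_1\oplus\mathbb{C}1_{X^*}$ such that $\sum_{n\ge0}\mathrm{Li}_{[S]_n}$ is unconditionally convergent in $\mathcal{H}(D_{<R})$;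 for such $S$, $\mathrm{Li}_S(z)=\sum_{n\ge0}\mathrm{Li}_{[S]_n}(z)$. In point 4, for $|z|=r$, $\mathrm{Li}_{\pi_X(Q)}(z)$ likewise means $\sum_{n\ge0}\mathrm{Li}_{\pi_X(Q_n)}(z)$, each $\mathrm{Li}_{\pi_X(Q_n)}(z)$ being the sum of its Taylor series at $z$. *)

(* Defs.v *)
From HB Require Import structures.
From mathcomp Require Import all_boot all_order all_algebra finmap.
From mathcomp Require Import all_classical all_reals all_analysis.
From mathcomp Require Import complex.
From mathcomp.analysis Require Import showcase.summability.
Set Implicit Arguments.
Unset Strict Implicit.
Unset Printing Implicit Defensive.
Import Order.TTheory GRing.Theory Num.Theory.
Import numFieldNormedType.Exports.
Local Open Scope classical_set_scope.
Local Open Scope ring_scope.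

(* [R[i]] itself carries no topology in the library; its regular module
   [R[i]^o] is a normed module over [R[i]], so that [derivable] on it means
   complex differentiability.  Norms are [R[i]]-valued; [cabs] is the modulus
   as an element of [R]. *)
Notation Cplx R := (R[i]^o)%type.

Definition cabs (R : realType) (z : Cplx R) : R := complex.Re `|z|.

Notation letterX := bool.
Definition x0 : letterX := false.
Definition x1 : letterX := true.

(* The letter y_n is the number n >= 1. *)
Notation letterY := {n : nat | (0 < n)%N}.

Notation ncseries R A := (seq A -> Cplx R).

Definition weight (v : seq letterY) : nat := (\sum_(s <- v) sval s)%N.

(* y_{s_1} ... y_{s_r} |-> x_0^{s_1 - 1} x_1 ... x_0^{s_r - 1} x_1 *)
Definition encode (v : seq letterY) : seq letterX :=
  flatten [seq rcons (nseq (sval s).-1 x0) x1 | s <- v].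

(* The words occurring in u shuffle v, listed with multiplicity. *)
Fixpoint shuffle_words (u : seq letterX) : seq letterX -> seq (seq letterX) :=
  if u is a :: u' then
    fix shuffle_u (v : seq letterX) : seq (seq letterX) :=
      if v is b :: v' then
        [seq a :: w | w <- shuffle_words u' v] ++ [seq b :: w | w <- shuffle_u v']
      else [:: u]
  else fun v => [:: v].

Section Series.
Variable R : realType.
Local Notation C := (Cplx R).
Implicit Types (S : ncseries R letterX) (Q : ncseries R letterY).

Definition empty_word : ncseries R letterX := fun w => (w == [::])%:R.

Definition concat_prod S1 S2 : ncseries R letterX :=
  fun w => \sum_(i < (size w).+1) S1 (take i w) * S2 (drop i w).

Definition concat_pow S n : ncseries R letterX := iter n (concat_prod S) empty_word.

(* The sum over n >= 1 of the powers of S; each coefficient is a finite sum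
   when S has no constant term. *)
Definition plus_closure S : ncseries R letterX :=
  fun w => \sum_(n \in [set n | (0 < n)%N]) concat_pow S n w.

Definition shuffle_prod S1 S2 : ncseries R letterX :=
  fun w => \sum_(p \in [set: seq letterX * seq letterX])
    S1 p.1 * S2 p.2 * (count_mem w (shuffle_words p.1 p.2))%:R.

Definition shuffle_pow S n : ncseries R letterX := iter n (shuffle_prod S) empty_word.

Definition minus_x1 : ncseries R letterX := fun w => - (w == [:: x1])%:R.

(* - (-x_1)^+ *)
Definition base1 : ncseries R letterX := fun w => - plus_closure minus_x1 w.

Definition summable_family (F : nat -> ncseries R letterX) : Prop :=
  forall w, finite_set [set n | F n w != 0].

Definition sum_family (F : nat -> ncseries R letterX) : ncseries R letterX :=
  fun w => \sum_(n \in [set: nat]) F n w.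

Definition length_part n S : ncseries R letterX :=
  fun w => if size w == n then S w else 0.

Definition weight_part n Q : ncseries R letterY :=
  fun v => if weight v == n then Q v else 0.

(* C<<X>> x_1 (+) C 1 *)
Definition ends_in_x1 S : Prop :=
  forall w, S w != 0 -> w = [::] \/ exists u, w = rcons u x1.

Definition only_x1 S : Prop := forall w, S w != 0 -> all (pred1 x1) w.

Definition piY S : ncseries R letterY := fun v => S (encode v).

(* [encode] is injective, so the sum has at most one term. *)
Definition piX Q : ncseries R letterX :=
  fun w => \sum_(v \in [set v | encode v = w]) Q v.

(* n_1 > ... > n_r > 0, where r is the length of v *)
Definition decreasing_indices (v : seq letterY) : set (seq nat) :=
  [set t | size t = size v /\ sorted gtn (rcons t 0%N)].

Definition mz_term (v : seq letterY) (t : seq nat) : C :=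
  \prod_(p <- zip t v) (p.1%:R ^+ sval p.2)^-1.

Definition H_word (v : seq letterY) (N : nat) : C :=
  \sum_(t \in [set t | decreasing_indices v t /\ (head 0%N t <= N)%N]) mz_term v t.

(* Coefficient of z^N in Li_w, for w = encode v: the terms with n_1 = N, or
   the constant 1 if v is empty. *)
Definition Li_word_coef (v : seq letterY) (N : nat) : C :=
  \sum_(t \in [set t | decreasing_indices v t /\ head 0%N t = N]) mz_term v t.

(* Li_w (z) for w = encode v *)
Definition Li_word (v : seq letterY) (z : C) : C :=
  limn (series (fun N => Li_word_coef v N * z ^+ N)).

(* Linear extensions to polynomials; those of [Li_word] and [Li_word_coef] are
   meant for P satisfying [ends_in_x1 P]. *)
Definition H_poly (P : ncseries R letterY) (N : nat) : C :=
  \sum_(v \in [set: seq letterY]) P v * H_word v N.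

Definition Li_poly (P : ncseries R letterX) (z : C) : C :=
  \sum_(v \in [set: seq letterY]) P (encode v) * Li_word v z.

Definition Li_poly_coef (P : ncseries R letterX) (N : nat) : C :=
  \sum_(v \in [set: seq letterY]) P (encode v) * Li_word_coef v N.

Definition disk (rho : R) : set C := [set z | cabs z < rho].

Definition holomorphic_on (D : set C) (f : C -> C) : Prop :=
  forall z, D z -> derivable f z 1.

(* Convergence, uniformly on the compact subsets of D, of the net of partial
   sums over the finite subsets of nat, to an element of H(D). *)
Definition unconditionally_convergent_in_H (D : set C) (f : nat -> C -> C) : Prop :=
  exists2 g : C -> C, holomorphic_on D g &
    {family [set K : set C | compact K /\ K `<=` D],
      partial_sum f @ totally --> g}.

Definition Dom_Li (rho : R) S : Prop :=
  ends_in_x1 S /\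
  unconditionally_convergent_in_H (disk rho) (fun n => Li_poly (length_part n S)).

Definition Li_series S (z : C) : C :=
  limn (series (fun n => Li_poly (length_part n S) z)).

(* h is the sequence of Taylor coefficients of Li_S(z) / (1 - z). *)
Definition is_H_of_series (rho : R) S (h : nat -> C) : Prop :=
  forall z : C, cabs z < rho ->
    series (fun N => h N * z ^+ N) @ \oo --> (Li_series S z / (1 - z) : C).

End Series.

(* Main.v *)
Require Import Defs.
From HB Require Import structures.
From mathcomp Require Import all_boot all_order all_algebra finmap.
From mathcomp Require Import all_classical all_reals all_analysis.
From mathcomp Require Import complex.
From mathcomp.analysis Require Import showcase.summability.
From mathcomp Require Import ring lra.
From mathcomp Require Import cyclic separable cyclotomic.
Import Order.TTheory GRing.Theory Num.Theory.
Import numFieldNormedType.Exports.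
Local Open Scope classical_set_scope.
Local Open Scope ring_scope.

Set Implicit Arguments.
Unset Strict Implicit.
Unset Printing Implicit Defensive.

(** Let f_n be the polylogarithm of the part of degree n of a series S, and c_{n,k}
    its Taylor coefficients at 0. The harmonic sum of the same part at N is
    H_{n,N} = c_{n,0} + ... + c_{n,N} (H_polyE), that is, the N-th Taylor
    coefficient of f_n(z) / (1 - z). The theorem is about two ways of summing
    the double arrays c and H.

    The sum of the f_n converges unconditionally in H(D) for the disk D of
    radius R if and only if |c_{n,k}| r^k is summable over all n and k for every
    r < R. The if part is the Weierstrass test, and the limit is the power
    series of the column sums of c (unconditional_of_rect_bounded). For the
    only if part (rect_bounded_of_unconditional), unconditional convergence
    bounds all finite subsums of the f_n by one constant M on a circle of radius
    r' with r < r' < R. Cauchy's inequality then bounds all finite subsums of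
    the column k of c by M / r'^k. If all finite subsums of a family of complex
    numbers are at most M, the moduli sum up to at most 4 M (sum_cabs_le4);
    hence column k contributes at most 4 M (r / r')^k, a geometric series.
    Cauchy's inequality is obtained by averaging over roots of unity.

    Division by 1 - z and multiplication by 1 - z carry summability from c to H
    (rect_cumul) and back (rect_uncumul), and summable double arrays can be
    summed by rows or by columns (csum_exchange). This gives the existence and
    absolute convergence of the harmonic sums of S (Dom_Li_harmonic_sums), with
    uniqueness by the identity theorem for power series (pseries_zero), and the
    converse (harmonic_sums_Dom_Li), where the exchange of sums is valid on the
    closed disk because summability is assumed at the radius r itself.

    A series in the powers of x_1, with coefficient s_n at the n-th power, is
    identified with F(t), the sum of the s_n t^n / n!; the shuffle product is then
    the product of functions. As the polylogarithm of the n-th power of x_1 is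
    (-log(1-z))^n / n!, the function attached to the series is F(-log(1-z)). To
    -(-x_1)^+ corresponds 1 - exp(-t), which the substitution turns into z; so its
    N-th shuffle power has polylogarithm z^N, and the sum of the a_N z^N is
    reached (log_subst_powers). Taking absolute values of all coefficients
    replaces 1 - exp(-t) by exp(t) - 1, hence z by z / (1-z), the N-th power of
    which has at z^k a coefficient bounded by the binomial coefficient of k and
    N (log_subst_le). If |a_N| <= A B'^N, column k of c is therefore at most
    A (1 + B')^k, which is summable against r^k as soon as r (1 + B') < 1; this
    is where the radius 1 / (B + 1) comes from. All these identities between
    generating functions are proved through the recurrences that their
    coefficients inherit from the differential equations. *)

#[local] Existing Instance totally_filter.

(** * The modulus of a complex number *)

Section Modulus.
Variable R : realType.
Local Notation C := (Cplx R).
Implicit Types (z w : C) (x : R).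

Lemma normCE z : `|z| = (cabs z)%:C%C :> R[i].
Proof. by rewrite /cabs [X in X = _]normc_def [in RHS]normc_def. Qed.

Lemma cabs_ge0 z : 0 <= cabs z.
Proof. by rewrite -ler0c -normCE. Qed.

Lemma cabsM z w : cabs (z * w) = cabs z * cabs w.
Proof. by apply: (@complexI R); rewrite rmorphM /= -!normCE -normrM. Qed.

Lemma cabsX z n : cabs (z ^+ n) = cabs z ^+ n.
Proof. by apply: (@complexI R); rewrite rmorphXn /= -!normCE -normrX. Qed.

Lemma cabsD z w : cabs (z + w) <= cabs z + cabs w.
Proof. by rewrite -lecR rmorphD /= -!normCE; exact: ler_normD. Qed.

Lemma cabsN z : cabs (- z) = cabs z.
Proof. by apply: (@complexI R); rewrite -!normCE -[LHS]/(`|- (z : R[i])|) normrN. Qed.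

Lemma cabsB z w : cabs (z - w) = cabs (w - z).
Proof. by rewrite -cabsN opprB. Qed.

Lemma cabs0_eq0 z : cabs z = 0 -> z = 0.
Proof. by move=> z0; apply/eqP; rewrite -normr_eq0 normCE z0. Qed.

Lemma cabs_real x : cabs (x%:C%C : C) = `|x|.
Proof. by rewrite /cabs normc_def /= expr0n /= addr0 sqrtr_sqr. Qed.

Lemma cabs_nat n : cabs (n%:R : C) = n%:R.
Proof. by apply: (@complexI R); rewrite -normCE normr_nat rmorph_nat. Qed.

Lemma cabs0 : cabs (0 : C) = 0. Proof. exact: (cabs_nat 0). Qed.
Lemma cabs1 : cabs (1 : C) = 1. Proof. exact: (cabs_nat 1). Qed.

Lemma cabsV z : cabs z^-1 = (cabs z)^-1.
Proof. by apply: (@complexI R); rewrite fmorphV /= -!normCE -[LHS]/(`|(z : R[i])^-1|) normfV. Qed.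

Lemma cabs_sum I (r : seq I) (P : pred I) (F : I -> C) :
  cabs (\sum_(i <- r | P i) F i) <= \sum_(i <- r | P i) cabs (F i).
Proof.
elim/big_ind2 : _ => //; first by rewrite cabs0.
by move=> x1 x2 y1 y2 h1 h2; apply: le_trans (cabsD _ _) _; apply: lerD.
Qed.

Lemma Re_le_cabs z : `|complex.Re z| <= cabs z.
Proof. by rewrite -lecR -normCE; exact: normc_ge_Re. Qed.

Lemma Im_le_cabs z : `|complex.Im z| <= cabs z.
Proof.
rewrite /cabs normc_def /= -sqrtr_sqr ler_wsqrtr // lerDr; exact: sqr_ge0.
Qed.

Lemma cabs_le_ReIm z : cabs z <= `|complex.Re z| + `|complex.Im z|.
Proof.
have -> : z = (complex.Re z)%:C%C + 'i%C * (complex.Im z)%:C%C :> R[i] by exact: complexE.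
have ->: complex.Re ((complex.Re z)%:C%C + 'i%C * (complex.Im z)%:C%C) = complex.Re z by rewrite -complexE.
have ->: complex.Im ((complex.Re z)%:C%C + 'i%C * (complex.Im z)%:C%C) = complex.Im z by rewrite -complexE.
apply: le_trans (cabsD _ _) _.
rewrite cabsM !cabs_real; have -> : cabs ('i%C : C) = 1.
  by rewrite /cabs normc_def /= expr0n /= add0r expr1n sqrtr1.
by rewrite mul1r.
Qed.

(** The norm on R[i] has values in R[i], whose order is partial; this moves
    all estimates to R. *)
Lemma cvg_cabsP {T} (F : set_system T) {FF : Filter F} (f : T -> C) (l : C) :
  f @ F --> l <-> forall e : R, 0 < e -> \forall x \near F, cabs (l - f x) < e.
Proof.
split=> [/cvgrPdist_lt h e e0|h].
  have /h : (0 : R[i]) < e%:C%C by rewrite ltcR.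
  by apply: filterS => x; rewrite normCE ltcR.
apply/cvgrPdist_lt => e e0.
have eE : e = (complex.Re e)%:C%C by rewrite RRe_real // gtr0_real.
have : 0 < complex.Re e by rewrite -ltcR -eE.
move=> /h; apply: filterS => x; by rewrite eE normCE ltcR.
Qed.

End Modulus.

(** * Absolutely convergent series and double series *)

Lemma seriesE (V : zmodType) (u : nat -> V) n : series u n = \sum_(k < n) u k.
Proof. by rewrite -(big_mkord xpredT). Qed.

Lemma sum_ord_sub (V : zmodType) (f : nat -> V) m n : (m <= n)%N ->
  \sum_(k < n) f k - \sum_(k < m) f k = \sum_(m <= k < n) f k.
Proof.
move=> mn; rewrite -!(big_mkord xpredT f) (big_cat_nat (leq0n m) mn) /=.
by rewrite addrAC subrr add0r.
Qed.

Section AbsSeries.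
Variable R : realType.
Local Notation C := (Cplx R).
Implicit Types (u v : nat -> C) (c : nat -> nat -> C) (M : R).

(** Absolute convergence is carried by an explicit bound on all partial sums
    of the moduli, so that a tail is estimated by the difference between the
    bound and a partial sum. *)
Definition abs_bounded u M := forall n, \sum_(k < n) cabs (u k) <= M.

Definition csum u : C := limn (series u).

Lemma cvg_ReIm u (a b : R) :
  (fun n => complex.Re (u n)) @ \oo --> a -> (fun n => complex.Im (u n)) @ \oo --> b ->
  u @ \oo --> (Complex a b : C).
Proof.
move=> /cvgrPdist_lt ua /cvgrPdist_lt ub; apply/cvg_cabsP => e e0.
have e20 : 0 < e / 2 by rewrite divr_gt0.
near=> n; apply: le_lt_trans (cabs_le_ReIm _) _; rewrite (splitr e) ltrD //.
- rewrite -[X in `|X|]/(complex.Re (Complex a b - u n)).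
  have -> : complex.Re (Complex a b - u n) = a - complex.Re (u n) by case: (u n).
  by near: n; exact: ua.
- have -> : complex.Im (Complex a b - u n) = b - complex.Im (u n) by case: (u n).
  by near: n; exact: ub.
Unshelve. all: by end_near. Qed.

Lemma Re_sum I (r : seq I) (P : pred I) (F : I -> C) :
  complex.Re (\sum_(i <- r | P i) F i) = \sum_(i <- r | P i) complex.Re (F i).
Proof. by apply: (big_morph (@complex.Re R)) => // -[a b] [a' b']. Qed.

Lemma Im_sum I (r : seq I) (P : pred I) (F : I -> C) :
  complex.Im (\sum_(i <- r | P i) F i) = \sum_(i <- r | P i) complex.Im (F i).
Proof. by apply: (big_morph (@complex.Im R)) => // -[a b] [a' b']. Qed.

Lemma real_abs_series_cvg (a : nat -> R) M :
  (forall n, \sum_(k < n) `|a k| <= M) -> cvgn (series a).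
Proof.
move=> aM; apply: normed_cvg; apply: nondecreasing_is_cvgn.
  by apply/nondecreasing_seqP => n; rewrite [leRHS]/series /= big_nat_recr //= lerDl.
by exists M => _ [n _ <-]; have := aM n; rewrite -(big_mkord xpredT (fun k => `|a k|)).
Qed.

Lemma abs_bounded_cvg u M : abs_bounded u M -> series u @ \oo --> csum u.
Proof.
move=> uM.
have cvRe : cvgn (series (fun k => complex.Re (u k))).
  apply: (@real_abs_series_cvg _ M) => n; apply: le_trans (uM n).
  by apply: ler_sum => k _; exact: Re_le_cabs.
have cvIm : cvgn (series (fun k => complex.Im (u k))).
  apply: (@real_abs_series_cvg _ M) => n; apply: le_trans (uM n).
  by apply: ler_sum => k _; exact: Im_le_cabs.
apply: cvgP; apply: cvg_ReIm; [move: cvRe|move: cvIm];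
 apply: cvg_trans; apply: near_eq_cvg; apply: nearW => n; by rewrite !seriesE ?Re_sum ?Im_sum.
Qed.

Lemma cvg_csum u l : series u @ \oo --> (l : C) -> csum u = l.
Proof. exact: cvg_lim. Qed.

Lemma cabs_lim_le (f : nat -> C) (l w : C) M :
  f @ \oo --> l -> (\forall n \near \oo, cabs (f n - w) <= M) -> cabs (l - w) <= M.
Proof.
move=> /cvg_cabsP fl fM; apply/ler_addgt0Pr => e e0.
near \oo => n.
have -> : l - w = (l - f n) + (f n - w) by rewrite addrA subrK.
apply: le_trans (cabsD _ _) _; rewrite addrC lerD //; first by near: n.
by apply: ltW; near: n; exact: fl.
Unshelve. all: by end_near. Qed.

Lemma cabs_sum_tail u m n : (m <= n)%N ->
  cabs (\sum_(k < n) u k - \sum_(k < m) u k) <=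
  \sum_(k < n) cabs (u k) - \sum_(k < m) cabs (u k).
Proof.
by move=> mn; rewrite (sum_ord_sub u mn) (sum_ord_sub (fun k => cabs (u k)) mn); exact: cabs_sum.
Qed.

(** When M is the supremum of the partial sums, the right-hand side is the
    tail of the series of moduli. *)
Lemma csum_tail u M n : abs_bounded u M ->
  cabs (csum u - \sum_(k < n) u k) <= M - \sum_(k < n) cabs (u k).
Proof.
move=> uM; apply: (cabs_lim_le (f := series u)); first exact: abs_bounded_cvg uM.
near=> m; rewrite seriesE; apply: le_trans (cabs_sum_tail _ (_ : (n <= m)%N)) _; first by near: m; exists n.
by rewrite lerB.
Unshelve. all: by end_near. Qed.

Lemma csum_bound u M : abs_bounded u M -> cabs (csum u) <= M.
Proof. by move=> uM; have := csum_tail 0 uM; rewrite !big_ord0 !subr0. Qed.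

Lemma abs_bounded_le u v M : (forall k, cabs (u k) <= cabs (v k)) ->
  abs_bounded v M -> abs_bounded u M.
Proof. by move=> uv vM n; apply: le_trans (vM n); apply: ler_sum. Qed.

Lemma cvg_scaleC T (F : set_system T) {FF : Filter F} (f : T -> C) (l a : C) :
  f @ F --> l -> (fun x => a * f x) @ F --> (a * l : C).
Proof.
move=> /cvg_cabsP fl; apply/cvg_cabsP => e e0.
have a0 : 0 < cabs a + 1 by rewrite ltr_wpDl ?cabs_ge0.
have /fl : 0 < e / (cabs a + 1) by rewrite divr_gt0.
apply: filterS => x h; rewrite -mulrBr cabsM.
rewrite ltr_pdivlMr // mulrC in h; apply: le_lt_trans h.
by rewrite ler_wpM2r ?cabs_ge0 // lerDl.
Qed.

Lemma cvg_addC T (F : set_system T) {FF : Filter F} (f g : T -> C) (l m : C) :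
  f @ F --> l -> g @ F --> m -> (fun x => f x + g x) @ F --> (l + m : C).
Proof.
move=> /cvg_cabsP fl /cvg_cabsP gm; apply/cvg_cabsP => e e0.
have e20 : 0 < e / 2 by rewrite divr_gt0.
near=> x.
have -> : l + m - (f x + g x) = (l - f x) + (m - g x) by rewrite opprD addrACA.
apply: le_lt_trans (cabsD _ _) _; rewrite (splitr e) ltrD //; near: x; [exact: fl|exact: gm].
Unshelve. all: by end_near. Qed.

Lemma cvg_sumC T (F : set_system T) {FF : Filter F} I (r : seq I) (P : pred I)
    (f : I -> T -> C) (l : I -> C) :
  (forall i, f i @ F --> l i) ->
  (fun x => \sum_(i <- r | P i) f i x) @ F --> (\sum_(i <- r | P i) l i : C).
Proof.
move=> h; elim: r => [|i r IH].
  by rewrite big_nil; under eq_fun do rewrite big_nil; exact: cvg_cst.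
rewrite big_cons; under eq_fun do rewrite big_cons.
by case: (P i); [exact: cvg_addC (h i) IH|exact: IH].
Qed.

Lemma csum_scale u M (a : C) : abs_bounded u M ->
  series (fun k => a * u k) @ \oo --> (a * csum u : C).
Proof.
move=> /abs_bounded_cvg /cvg_scaleC - /(_ a).
by apply: cvg_trans; apply: near_eq_cvg; apply: nearW => n; rewrite !seriesE mulr_sumr.
Qed.

Lemma csum_mulr u M (a : C) : abs_bounded u M ->
  csum (fun k => u k * a) = csum u * a.
Proof.
move=> uM; apply: cvg_csum; rewrite mulrC.
by under eq_fun do rewrite mulrC; exact: csum_scale uM.
Qed.

Definition rect c n k : R := \sum_(i < n) \sum_(j < k) cabs (c i j).
(** Absolute convergence of a double series: since finite sets of indices lie
    in rectangles, it is enough to bound the sums over rectangles. *)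
Definition rect_bounded c M := forall n k, rect c n k <= M.

Lemma rect_swap c n k : rect (fun i j => c j i) n k = rect c k n.
Proof. exact: exchange_big. Qed.

Lemma rect_bounded_swap c M : rect_bounded c M -> rect_bounded (fun i j => c j i) M.
Proof. by move=> cM n k; rewrite rect_swap. Qed.

Lemma rect_mono c n n' k k' : (n <= n')%N -> (k <= k')%N -> rect c n k <= rect c n' k'.
Proof.
move=> nn kk; rewrite /rect.
apply: (@le_trans _ _ (\sum_(i < n) \sum_(j < k') cabs (c i j))).
  apply: ler_sum => i _; rewrite -!(big_mkord xpredT (fun j => cabs (c i j))) (big_cat_nat (leq0n k) kk) //= lerDl.
  by apply: sumr_ge0 => *; exact: cabs_ge0.
rewrite -!(big_mkord xpredT (fun i => \sum_(j < k') cabs (c i j))) (big_cat_nat (leq0n n) nn) //= lerDl.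
by apply: sumr_ge0 => *; apply: sumr_ge0 => *; exact: cabs_ge0.
Qed.

Lemma rect_bounded_row c M i : rect_bounded c M -> abs_bounded (c i) M.
Proof.
move=> cM k; apply: le_trans (cM i.+1 k); rewrite /rect big_ord_recr /= lerDr.
by apply: sumr_ge0 => *; apply: sumr_ge0 => *; exact: cabs_ge0.
Qed.

(** The difference is a sum over the part of the first n rows outside the n by
    k rectangle, whose mass of moduli is at most what M leaves after the
    rectangle. *)
Lemma rows_tail c M n k : rect_bounded c M ->
  cabs (\sum_(i < n) csum (c i) - \sum_(i < n) \sum_(j < k) c i j) <= M - rect c n k.
Proof.
move=> cM.
apply: (cabs_lim_le (f := fun k' => \sum_(i < n) series (c i) k')).
  by apply: cvg_sumC => i; exact: abs_bounded_cvg (rect_bounded_row i cM).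
near=> k'.
have kk' : (k <= k')%N by near: k'; exists k.
rewrite -sumrB; apply: le_trans (cabs_sum _ _ _) _.
apply: (@le_trans _ _ (rect c n k' - rect c n k)); last by rewrite lerB.
rewrite /rect -sumrB; apply: ler_sum => i _; rewrite seriesE.
exact: cabs_sum_tail.
Unshelve. all: by end_near. Qed.

(** Finitely many rows can be cut at a common column k with an error e / n in
    each; the truncated rows form a rectangle. *)
Lemma rows_bounded c M : rect_bounded c M -> abs_bounded (fun i => csum (c i)) M.
Proof.
move=> cM n; apply/ler_addgt0Pr => e e0.
have [n1|n0] := posnP n; first by rewrite n1 big_ord0; apply: le_trans (ltW e0) _; rewrite lerDr; have := cM 0 0; rewrite /rect big_ord0.
have en0 : 0 < e / n%:R by rewrite divr_gt0 // ltr0n.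
have [k hk] : exists k, forall i : 'I_n, cabs (csum (c i) - \sum_(j < k) c i j) <= e / n%:R.
  have : \forall k \near \oo, forall i : 'I_n, cabs (csum (c i) - \sum_(j < k) c i j) <= e / n%:R.
    apply: filter_forall => i.
    have /cvg_cabsP/(_ _ en0) := abs_bounded_cvg (rect_bounded_row i cM).
    by apply: filterS => k; rewrite seriesE => /ltW.
  by case/filter_ex => k hk; exists k.
apply: (@le_trans _ _ (rect c n k + e)); last by rewrite lerD2r.
have -> : e = \sum_(i < n) e / n%:R.
  by rewrite sumr_const card_ord -[RHS]mulr_natr divfK // pnatr_eq0 -lt0n.
rewrite /rect -big_split; apply: ler_sum => i _ /=.
have -> : csum (c i) = (\sum_(j < k) c i j) + (csum (c i) - \sum_(j < k) c i j) by rewrite addrC subrK.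
by apply: le_trans (cabsD _ _) _; apply: lerD; [exact: cabs_sum|exact: hk].
Qed.

(** With the supremum of the rectangles in place of M, the differences M' -
    rect c n k become arbitrarily small; this is what feeds rows_tail. *)
Lemma rect_sup c M e : rect_bounded c M -> 0 < e ->
  exists M', rect_bounded c M' /\ exists n k, M' - e < rect c n k.
Proof.
move=> cM e0; pose A := [set x | exists n k, x = rect c n k].
have supA : has_sup A by split; [exists (rect c 0 0), 0%N, 0%N|exists M => _ [n [k ->]]].
exists (sup A); split.
  by move=> n k; apply: ub_le_sup; [case: supA|exists n, k].
have [_ [n [k ->]] h] := sup_adherent e0 supA.
by exists n, k.
Qed.

(** Both iterated sums are close to the sum over one large rectangle, because
    each of them differs from it by a sum over indices outside that rectangle.
    *)
Lemma csum_exchange c M : rect_bounded c M ->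
  series (fun i => csum (c i)) @ \oo --> csum (fun j => csum (fun i => c i j)).
Proof.
move=> cM; have cM' := rect_bounded_swap cM.
have /cvg_cabsP cv := abs_bounded_cvg (rows_bounded cM').
apply/cvg_cabsP => e e0; have e40 : 0 < e / 4 by lra.
(* One quarter of e for each of the two tails outside the rectangle and one
    for the truncation of the column sums. *)
have [M' [cM1 [n0 [k0 h]]]] := rect_sup cM e40.
near=> n; near \oo => k.
have : cabs (csum (fun j => csum (fun i => c i j)) - series (fun j => csum (fun i => c i j)) k) < e / 4.
  by near: k; exact: cv.
rewrite !seriesE => h1.
have h2 := rows_tail n k cM1.
have h3 := rows_tail k n (rect_bounded_swap cM1).
rewrite rect_swap exchange_big /= in h3.
have h4 : rect c n0 k0 <= rect c n k by apply: rect_mono; [near: n; exists n0|near: k; exists k0].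
set s := csum _ in h1 *; set a := \sum_(i < n) csum _ in h2 *.
set b := \sum_(j < k) csum _ in h1 h3; set d := \sum_(i < n) _ in h2 h3.
rewrite cabsB in h2.
have -> : s - a = (s - b) + ((b - d) + (d - a)) by rewrite !addrA !subrK.
have := cabsD (s - b) ((b - d) + (d - a)).
have := cabsD (b - d) (d - a).
by move: h h1 h2 h3 h4; lra.
Unshelve. all: by end_near. Qed.

Lemma rect_fsbig c n k :
  ((rect c n k)%:E = \sum_(p \in `I_n `*` `I_k) (cabs (c p.1 p.2))%:E)%E.
Proof.
rewrite -(@pair_fsbig _ _ _ _ _ _ _ (fun i j => (cabs (c i j))%:E)) //.
by rewrite -fsbig_ord /rect -sumEFin; apply: eq_bigr => i _; rewrite -fsbig_ord sumEFin.
Qed.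

(** A finite set of pairs of natural numbers lies in a square. *)
Lemma esum_rect c : (\esum_(p in [set: nat * nat]) (cabs (c p.1 p.2))%:E < +oo)%E <->
  exists M, rect_bounded c M.
Proof.
split=> [h|[M cM]].
  exists (fine (\esum_(p in [set: nat * nat]) (cabs (c p.1 p.2))%:E)%E) => n k.
  rewrite -lee_fin fineK; last first.
    by rewrite ge0_fin_numE // esum_ge0 // => p _; rewrite lee_fin cabs_ge0.
  apply: esum_ge; exists (`I_n `*` `I_k); last by rewrite rect_fsbig.
  by split=> //; exact: finite_setX.
apply: (@le_lt_trans _ _ M%:E); last exact: ltry.
apply: ge_ereal_sup => _ [F [finF _] <-].
pose n := (\max_(p <- fset_set F) maxn p.1 p.2).+1.
apply: le_trans (_ : (rect c n n)%:E <= _)%E; last by rewrite lee_fin.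
rewrite rect_fsbig; apply: lee_fsum_nneg_subset => //.
- exact: finite_setX.
- move=> p pF; rewrite inE /=.
  have : (maxn p.1 p.2 < n)%N.
    by rewrite /n ltnS; apply: (@leq_bigmax_seq _ _ _ (fun p => maxn p.1 p.2)) => //; rewrite in_fset_set.
  by rewrite gtn_max => /andP[].
- by move=> p _; rewrite lee_fin cabs_ge0.
Qed.

Lemma esum_abs u : (\esum_(n in [set: nat]) (cabs (u n))%:E < +oo)%E <->
  exists M, abs_bounded u M.
Proof.
have sumE n : ((\sum_(k < n) cabs (u k))%:E = \sum_(k \in `I_n) (cabs (u k))%:E)%E.
  by rewrite -fsbig_ord sumEFin.
split=> [h|[M cM]].
  exists (fine (\esum_(p in [set: nat]) (cabs (u p))%:E)%E) => n.
  rewrite -lee_fin fineK; last first.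
    by rewrite ge0_fin_numE // esum_ge0 // => p _; rewrite lee_fin cabs_ge0.
  by apply: esum_ge; exists (`I_n); [split|rewrite sumE].
apply: (@le_lt_trans _ _ M%:E); last exact: ltry.
apply: ge_ereal_sup => _ [F [finF _] <-].
pose n := (\max_(p <- fset_set F) p).+1.
apply: le_trans (_ : (\sum_(k < n) cabs (u k))%:E <= _)%E; last by rewrite lee_fin.
rewrite sumE; apply: lee_fsum_nneg_subset => //.
- move=> p pF; rewrite inE /= /n ltnS.
  by apply: (@leq_bigmax_seq _ _ _ id) => //; rewrite in_fset_set.
- by move=> p _; rewrite lee_fin cabs_ge0.
Qed.

End AbsSeries.

(** * Uniform convergence and compact subsets of disks *)

Section Topology.
Variable R : realType.
Local Notation C := (Cplx R).

Lemma cvg_uniform_onP T (F : set_system T) {FF : Filter F} (K : set C)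
    (f : T -> C -> C) (g : C -> C) :
  {uniform K, f @ F --> g} <->
  forall e : R, 0 < e -> \forall i \near F, forall z, K z -> cabs (g z - f i z) < e.
Proof.
split=> [fg e e0|fg P /uniform_nbhs[E [entE EP]]].
  have eC0 : 0 < e%:C%C :> R[i] by rewrite ltcR.
  apply: (fg [set h : C -> C | forall z, K z -> cabs (g z - h z) < e]).
  apply/uniform_nbhs; exists [set xy | ball xy.1 e%:C%C xy.2]; split.
    exact: (entourage_ball _ (PosNum eC0)).
  by move=> h /= hE z Kz; have := hE z Kz; rewrite -ball_normE /= normCE ltcR.
move: entE; rewrite -entourage_from_ballE => -[eC /= eC0 EE].
have eE : eC = (complex.Re eC)%:C%C by rewrite RRe_real // gtr0_real.
have /fg : 0 < complex.Re eC by rewrite -ltcR -eE.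
apply: filterS => i hi; apply: EP => z Kz; apply: EE => /=.
by rewrite -ball_normE /= eE normCE ltcR; exact: hi.
Qed.

Lemma continuous_cabs : continuous (@cabs R).
Proof.
move=> z; apply/(@cvgrPdist_lt _ _ _ (nbhs z)) => e e0.
have := (@cvg_cabsP R _ (nbhs z) (nbhs_filter z) id z).1 cvg_id e e0.
apply: filterS => w; apply: le_lt_trans; rewrite ler_norml; apply/andP; split.
  rewrite lerNl opprB lerBlDr cabsB; apply: le_trans (cabsD _ _).
  by rewrite subrK.
by rewrite lerBlDr; apply: le_trans (cabsD _ _); rewrite subrK.
Qed.

Lemma continuous_Complex : continuous (fun p : R * R => Complex p.1 p.2 : C).
Proof.
move=> [a b]; apply/cvg_cabsP => e e0; have e20 : 0 < e / 2 by rewrite divr_gt0.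
near=> p; apply: le_lt_trans (cabs_le_ReIm _) _; rewrite (splitr e) ltrD //=.
- near: p; have : (fun p : R * R => p.1) @ (a, b) --> a by exact: cvg_fst.
  by move=> /cvgrPdist_lt; exact.
- near: p; have : (fun p : R * R => p.2) @ (a, b) --> b by exact: cvg_snd.
  by move=> /cvgrPdist_lt; exact.
Unshelve. all: by end_near. Qed.

(** A closed disk is closed, and contained in the image of a compact square of
    R * R. *)
Lemma compact_closed_disk (r : R) : compact [set z : C | cabs z <= r].
Proof.
apply: (@subclosed_compact _ _ ((fun p : R * R => Complex p.1 p.2 : C) @` (`[- r, r] `*` `[- r, r]))).
- apply: (@preimage_closed _ _ (@cabs R) [set x | x <= r]); last exact: closed_le.
  by move=> z _; exact: continuous_cabs.
- apply: continuous_compact; last by apply: compact_setX; exact: segment_compact.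
  exact/continuous_subspaceT/continuous_Complex.
- move=> z /= zr; exists (complex.Re z, complex.Im z); last by case: z {zr}.
  by split; rewrite /= in_itv /= -ler_norml; apply: le_trans zr; [exact: Re_le_cabs|exact: Im_le_cabs].
Qed.

(** The modulus attains its maximum on K; rho / 2 is there only to keep the
    radius positive. *)
Lemma compact_in_disk (rho : R) (K : set C) : 0 < rho -> compact K -> K `<=` disk rho ->
  exists r, [/\ 0 < r, r < rho & forall z, K z -> cabs z <= r].
Proof.
move=> rho0 cK Krho.
have [->|/set0P K0] := eqVneq K set0.
  by exists (rho / 2); split => //; [rewrite divr_gt0|rewrite ltr_pdivrMr // ltr_pMr // ltr1n].
have [w wK wmax] : exists2 c, c \in K & forall t, t \in K -> cabs t <= cabs c.
  by apply: compact_EVT_max => //; exact/continuous_subspaceT/continuous_cabs.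
have wrho : cabs w < rho by apply: Krho; rewrite -inE.
exists (Num.max (cabs w) (rho / 2)); split.
- by rewrite lt_max [X in _ || X]divr_gt0 // orbT.
- by rewrite gt_max wrho ltr_pdivrMr // ltr_pMr // ltr1n.
- by move=> z Kz; rewrite le_max wmax ?inE.
Qed.

End Topology.

(** * Cauchy's inequality for polynomials *)

Section RootsOfUnity.

(** In characteristic 0 the polynomial X^n - 1 is separable, so it has n
    distinct roots in an algebraically closed field. *)
Lemma exists_prim_root (F : numClosedFieldType) n : (0 < n)%N -> exists w : F, n.-primitive_root w.
Proof.
move=> n0; pose p : {poly F} := 'X^n - 1.
have [rs Dp] := closed_field_poly_normal p.
rewrite (monicP _) ?monicXnsubC // scale1r in Dp.
have rn1 : all n.-unity_root rs by apply/allP => z; rewrite -root_prod_XsubC -Dp.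
have sz : (n < (size rs).+1)%N by rewrite -(size_prod_XsubC rs id) -Dp size_XnsubC.
have [|z] := hasP (has_prim_root n0 rn1 _ sz); last by exists z.
by rewrite -separable_prod_XsubC -Dp separable_Xn_sub_1 // pnatr_eq0 -lt0n.
Qed.

(** A geometric sum whose ratio w^i / w^k is an n-th root of unity, and equals
    1 only if i = k. *)
Lemma unity_root_sum (F : fieldType) n (w : F) i k : n.-primitive_root w -> (i < n)%N -> (k < n)%N ->
  \sum_(j < n) (w ^+ j) ^+ i / (w ^+ j) ^+ k = if i == k then n%:R else 0.
Proof.
move=> pw lin lkn; have n0 := prim_order_gt0 pw.
have w0 : w != 0 by apply: contra_eqN (prim_expr_order pw) => /eqP ->; rewrite expr0n gtn_eqF // eq_sym oner_eq0.
have E j : (w ^+ j) ^+ i / (w ^+ j) ^+ k = (w ^+ i / w ^+ k) ^+ j.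
  by rewrite expr_div_n -!exprM ![(j * _)%N]mulnC.
under eq_bigr do rewrite E.
case: eqVneq => [->|ik].
  under eq_bigr do rewrite divff ?expf_neq0 // expr1n.
  by rewrite sumr_const card_ord.
have q1 : w ^+ i / w ^+ k - 1 != 0.
  rewrite subr_eq0 -[X in _ == X](divff (expf_neq0 k w0)) (inj_eq (divIf (expf_neq0 k w0))).
  by rewrite (eq_prim_root_expr pw) !modn_small.
apply: (mulfI q1); rewrite -subrX1 mulr0 expr_div_n -!exprM ![(_ * n)%N]mulnC !exprM.
by rewrite (prim_expr_order pw) !expr1n divff ?oner_neq0 // subrr.
Qed.

(** The average over the n-th roots of unity plays the role of the Cauchy
    integral: it extracts a coefficient of a polynomial of degree less than n
    from its values on the unit circle. *)
Lemma dft_inversion (F : fieldType) n (w : F) (u : nat -> F) k :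
  n.-primitive_root w -> (k < n)%N ->
  n%:R * u k = \sum_(j < n) (\sum_(i < n) u i * (w ^+ j) ^+ i) / (w ^+ j) ^+ k.
Proof.
move=> pw lkn.
under eq_bigr do rewrite mulr_suml; rewrite exchange_big /=.
transitivity (\sum_(i < n) u i * (if i == k :> nat then n%:R else 0)); last first.
  apply: eq_bigr => i _; rewrite -(unity_root_sum pw (ltn_ord i) lkn) mulr_sumr.
  by apply: eq_bigr => j _; rewrite mulrA.
rewrite (bigD1 (Ordinal lkn)) //= eqxx mulrC big1 ?addr0 // => i.
by rewrite -val_eqE /= => /negPf ->; rewrite mulr0.
Qed.

End RootsOfUnity.

Section Cauchy.
Variable R : realType.
Local Notation C := (Cplx R).
Implicit Types (u : nat -> C) (M r : R).

Lemma unity_root_cabs n (w : R[i]) : (0 < n)%N -> w ^+ n = 1 -> cabs w = 1.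
Proof.
move=> n0 wn; apply/eqP; rewrite -(@pexpr_eq1 _ _ n) ?cabs_ge0 -?lt0n //.
by rewrite -cabsX wn cabs1.
Qed.

(** By dft_inversion a coefficient is an average of values on the unit circle,
    each divided by a number of modulus 1. *)
Lemma poly_coef_bound u n M : (forall w : C, cabs w = 1 -> cabs (\sum_(i < n) u i * w ^+ i) <= M) ->
  forall k, (k < n)%N -> cabs (u k) <= M.
Proof.
move=> uM k lkn; have n0 : (0 < n)%N by apply: leq_ltn_trans lkn.
have [w pw] := @exists_prim_root R[i] n n0.
have w1 : cabs w = 1 by apply: unity_root_cabs n0 (prim_expr_order pw).
have E := dft_inversion u pw lkn.
have : cabs (n%:R * u k : C) <= n%:R * M.
  rewrite E; apply: le_trans (cabs_sum _ _ _) _.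
  rewrite -[n%:R in leRHS](_ : \sum_(j < n) 1 = _) ?mulr_suml; last by rewrite sumr_const card_ord.
  apply: ler_sum => j _; rewrite mul1r cabsM cabsV !cabsX w1 !expr1n invr1 mulr1.
  by apply: uM; rewrite cabsX w1 expr1n.
by rewrite cabsM cabs_nat ler_pM2l // ltr0n.
Qed.

End Cauchy.

(** * Power series *)

Section PowerSeries.
Variable R : realType.
Local Notation C := (Cplx R).
Implicit Types (u v : nat -> C) (c : nat -> nat -> C) (M r : R) (z : C).

Definition psum u z : C := csum (fun k => u k * z ^+ k).

(** Absolute convergence at r, stated with the complex number r so that the
    summand has the shape of a term of the power series. *)
Definition pow_bounded u r M := abs_bounded (fun k => u k * (r%:C%C : C) ^+ k) M.

Lemma abs_bounded_sup u M e : abs_bounded u M -> 0 < e ->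
  exists M', abs_bounded u M' /\ exists n, M' - e < \sum_(k < n) cabs (u k).
Proof.
move=> uM e0; pose A := [set x | exists n, x = \sum_(k < n) cabs (u k)].
have supA : has_sup A by split; [exists (\sum_(k < 0) cabs (u k)), 0%N|exists M => _ [n ->]].
exists (sup A); split.
  by move=> n; apply: ub_le_sup; [case: supA|exists n].
have [_ [n ->] h] := sup_adherent e0 supA.
by exists n.
Qed.

Lemma abs_sum_mono u m n : (m <= n)%N ->
  \sum_(k < m) cabs (u k) <= \sum_(k < n) cabs (u k).
Proof.
move=> mn; rewrite -subr_ge0 (sum_ord_sub (fun k => cabs (u k)) mn).
by apply: sumr_ge0 => i _; exact: cabs_ge0.
Qed.

Lemma cabs_realge0 r : 0 <= r -> cabs (r%:C%C : C) = r.
Proof. by move=> r0; rewrite cabs_real ger0_norm. Qed.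

Lemma pow_bounded_le u r M z : 0 <= r -> cabs z <= r -> pow_bounded u r M ->
  abs_bounded (fun k => u k * z ^+ k) M.
Proof.
move=> r0 zr; apply: abs_bounded_le => k.
by rewrite !cabsM !cabsX cabs_realge0 // ler_wpM2l ?cabs_ge0 // lerXn2r ?nnegrE ?cabs_ge0.
Qed.

(** A truncation so long that the tail is at most e on the whole circle is a
    polynomial bounded there by M + e. *)
Lemma cauchy_estimate u r A M : 0 <= r -> pow_bounded u r A ->
  (forall z, cabs z = r -> cabs (psum u z) <= M) ->
  forall k, cabs (u k) * r ^+ k <= M.
Proof.
move=> r0 uA uM k; apply/ler_addgt0Pr => e e0.
have [A' [uA' [n0 hn0]]] := abs_bounded_sup uA e0.
pose n := maxn n0 k.+1.
have -> : cabs (u k) * r ^+ k = cabs (u k * (r%:C%C : C) ^+ k).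
  by rewrite cabsM cabsX cabs_realge0.
apply: (@poly_coef_bound _ (fun k => u k * (r%:C%C : C) ^+ k) n); last by rewrite leq_max ltnSn orbT.
move=> w w1; pose z : C := r%:C%C * w.
have zr : cabs z = r by rewrite cabsM cabs_realge0 // w1 mulr1.
have -> : \sum_(i < n) u i * (r%:C%C : C) ^+ i * w ^+ i = \sum_(i < n) u i * z ^+ i.
  by apply: eq_bigr => i _; rewrite exprMn mulrA.
have uz : abs_bounded (fun k => u k * z ^+ k) A'.
  by apply: pow_bounded_le uA'; rewrite ?zr.
have := csum_tail n uz; rewrite -/(psum u z) => h.
have E : \sum_(k < n) cabs (u k * z ^+ k) = \sum_(k < n) cabs (u k * (r%:C%C : C) ^+ k).
  by apply: eq_bigr => i _; rewrite !cabsM !cabsX zr cabs_realge0.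
have nn : (n0 <= n)%N by rewrite leq_max leqnn.
have := abs_sum_mono (fun k => u k * (r%:C%C : C) ^+ k) nn.
rewrite cabsB in h; rewrite E in h.
have := uM z zr; have := cabsD (\sum_(i < n) u i * z ^+ i - psum u z) (psum u z).
rewrite subrK; lra.
Qed.

(** Split the real parts, and the imaginary parts, according to their signs:
    each of the four sums of absolute values is bounded by one of the subsums.
    *)
Lemma sum_cabs_le4 (x : nat -> C) M n :
  (forall P : pred nat, cabs (\sum_(k < n | P k) x k) <= M) ->
  \sum_(k < n) cabs (x k) <= 4 * M.
Proof.
move=> xM.
have key (f : nat -> R) : (forall P : pred nat, `|\sum_(k < n | P k) f k| <= M) ->
    \sum_(k < n) `|f k| <= 2 * M.
  move=> fM; rewrite (bigID (fun k : 'I_n => 0 <= f k)) /= mulr_natl mulr2n; apply: lerD.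
    apply: le_trans (fM (fun k => 0 <= f k)); apply: le_trans (ler_norm _).
    by apply: ler_sum => k fk; rewrite ger0_norm.
  apply: le_trans (fM (fun k => ~~ (0 <= f k))); rewrite -normrN; apply: le_trans (ler_norm _).
  by rewrite -sumrN; apply: ler_sum => k; rewrite -ltNge => fk; rewrite ltr0_norm.
have h1 : \sum_(k < n) `|complex.Re (x k)| <= 2 * M.
  by apply: (key (fun k => complex.Re (x k))) => P; rewrite -Re_sum; apply: le_trans (Re_le_cabs _) (xM P).
have h2 : \sum_(k < n) `|complex.Im (x k)| <= 2 * M.
  by apply: (key (fun k => complex.Im (x k))) => P; rewrite -Im_sum; apply: le_trans (Im_le_cabs _) (xM P).
apply: (@le_trans _ _ (\sum_(k < n) (`|complex.Re (x k)| + `|complex.Im (x k)|))).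
  by apply: ler_sum => k _; exact: cabs_le_ReIm.
by rewrite big_split /=; move: h1 h2; lra.
Qed.

(** Dominated convergence for series: cut at an n after which the dominating
    series has a small tail, and take the limit in the finite sum that
    remains. *)
Lemma tannery T (F : set_system T) {FF : Filter F} (f : nat -> T -> C) (l v : nat -> C) M :
  abs_bounded v M -> (\forall x \near F, forall k, cabs (f k x) <= cabs (v k)) ->
  (forall k, cabs (l k) <= cabs (v k)) -> (forall k, f k @ F --> l k) ->
  (fun x => csum (fun k => f k x)) @ F --> csum l.
Proof.
move=> vM fv lv fl; apply/cvg_cabsP => e e0; have e30 : 0 < e / 3 by lra.
have [M' [vM' [n hn]]] := abs_bounded_sup vM e30.
have tailE (w : nat -> C) : (forall k, cabs (w k) <= cabs (v k)) ->
    cabs (csum w - \sum_(k < n) w k) < e / 3.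
  move=> wv; apply: le_lt_trans (_ : M' - \sum_(k < n) cabs (v k) < _); last by lra.
  apply: (cabs_lim_le (f := series w)); first exact: abs_bounded_cvg (abs_bounded_le wv vM').
  near=> m; have nm : (n <= m)%N by near: m; exists n.
  rewrite seriesE; apply: le_trans (cabs_sum_tail w nm) _.
  apply: (@le_trans _ _ (\sum_(k < m) cabs (v k) - \sum_(k < n) cabs (v k))); last by rewrite lerB.
  rewrite (sum_ord_sub (fun k => cabs (v k)) nm) (sum_ord_sub (fun k => cabs (w k)) nm).
  by apply: ler_sum.
have /cvg_cabsP/(_ _ e30) sf : (fun x => \sum_(k < n) f k x) @ F --> (\sum_(k < n) l k : C).
  by apply: cvg_sumC.
near=> x.
have h1 := tailE l lv.
have h2 : cabs (csum (fun k => f k x) - \sum_(k < n) f k x) < e / 3.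
  by apply: tailE; near: x.
have h3 : cabs (\sum_(k < n) l k - \sum_(k < n) f k x) < e / 3 by near: x.
rewrite cabsB in h2.
set a := \sum_(k < n) l k in h1 h3; set b := \sum_(k < n) f k x in h2 h3.
have -> : csum l - csum (fun k => f k x) = (csum l - a) + ((a - b) + (b - csum (fun k => f k x))).
  by rewrite !addrA !subrK.
have := cabsD (csum l - a) ((a - b) + (b - csum (fun k => f k x))).
have := cabsD (a - b) (b - csum (fun k => f k x)).
by move: h1 h2 h3; lra.
Unshelve. all: by end_near. Qed.

Lemma cvg_mulC T (F : set_system T) {FF : Filter F} (f g : T -> C) (l m : C) :
  f @ F --> l -> g @ F --> m -> (fun x => f x * g x) @ F --> (l * m : C).
Proof.
move=> fl gm.
have -> : (fun x => f x * g x) = (fun x => (f x - l) * (g x - m) + (l * g x + m * (f x - l))).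
  by apply/funext => x; ring.
have -> : l * m = 0 + (l * m + m * 0) by ring.
have fl0 : (fun x => f x - l) @ F --> (0 : C).
  apply/cvg_cabsP => e e0; move/cvg_cabsP: fl => /(_ e e0); apply: filterS => x.
  by rewrite sub0r opprB.
apply: cvg_addC; last by apply: cvg_addC; exact: cvg_scaleC.
apply/cvg_cabsP => e e0; pose d := Num.min 1 e.
have d0 : 0 < d by rewrite lt_min ltr01.
move/cvg_cabsP: fl => /(_ d d0) h1; move/cvg_cabsP: gm => /(_ d d0) h2.
near=> x; rewrite sub0r cabsN cabsM cabsB (cabsB (g x)).
have : cabs (l - f x) < d by near: x.
have : cabs (m - g x) < d by near: x.
rewrite !lt_min => /andP[a1 a2] /andP[b1 b2].
apply: le_lt_trans a2; rewrite ler_piMl ?cabs_ge0 //; exact: ltW.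
Unshelve. all: by end_near. Qed.

Lemma cvg_expC T (F : set_system T) {FF : Filter F} (f : T -> C) (l : C) n :
  f @ F --> l -> (fun x => f x ^+ n) @ F --> (l ^+ n : C).
Proof.
move=> fl; elim: n => [|n IH]; first by under eq_fun do rewrite expr0; exact: cvg_cst.
by rewrite exprS; under eq_fun do rewrite exprS; exact: cvg_mulC.
Qed.

End PowerSeries.

Section Disk.
Variable R : realType.
Local Notation C := (Cplx R).
Implicit Types (u v : nat -> C) (c : nat -> nat -> C) (M r rho : R) (z : C).

Lemma abs_bounded_scale u M (a : C) : abs_bounded u M ->
  abs_bounded (fun k => a * u k) (cabs a * M).
Proof.
move=> uM n; under eq_bigr do rewrite cabsM.
by rewrite -mulr_sumr ler_wpM2l ?cabs_ge0.
Qed.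

Lemma csum_lin u v M M' (a : C) : abs_bounded u M -> abs_bounded v M' ->
  csum (fun k => a * (u k - v k)) = a * (csum u - csum v).
Proof.
move=> uM vM; apply: cvg_csum.
have -> : csum u - csum v = csum u + (- 1) * csum v by rewrite mulN1r.
have h : (fun n => a * (series u n + series (fun k => -1 * v k) n)) @ \oo -->
    (a * (csum u + -1 * csum v) : C).
  apply: cvg_scaleC; apply: cvg_addC; first exact: abs_bounded_cvg uM.
  exact: csum_scale vM.
move: h; apply: cvg_trans; apply: near_eq_cvg; apply: nearW => n.
have E : \sum_(k < n) a * (u k - v k) = a * (\sum_(k < n) u k + \sum_(k < n) -1 * v k).
  by rewrite -big_split mulr_sumr; apply: eq_bigr => i _; rewrite /= mulN1r.
by rewrite !seriesE E.
Qed.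

(** The sum is the divided difference of the k-th power between w and z.
    Comparison with the same sum at r2 and r1, equal to (r2^k - r1^k) / (r2 -
    r1), bounds it by a geometric term with no factor k. *)
Lemma sub_exp_bound (z w : C) k r1 r2 : cabs z <= r1 -> cabs w <= r1 -> r1 < r2 ->
  cabs (\sum_(i < k) w ^+ (k.-1 - i) * z ^+ i) <= (r2 - r1)^-1 * r2 ^+ k.
Proof.
move=> zr wr r12; have r10 : 0 <= r1 by apply: le_trans zr; exact: cabs_ge0.
have r20 : 0 <= r2 by apply: le_trans (ltW r12).
apply: le_trans (cabs_sum _ _ _) _.
apply: (@le_trans _ _ (\sum_(i < k) r2 ^+ (k.-1 - i) * r1 ^+ i)).
  apply: ler_sum => i _; rewrite cabsM !cabsX.
  apply: ler_pM; rewrite ?exprn_ge0 ?cabs_ge0 //; rewrite lerXn2r ?nnegrE ?cabs_ge0 //.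
  exact: le_trans (ltW r12).
have := subrXX r2 r1 k; rewrite [leRHS]mulrC => E.
rewrite ler_pdivlMr ?subr_gt0 // mulrC -E lerBlDr lerDl; exact: exprn_ge0.
Qed.

(** The difference quotient at z is the series of the u_k times the divided
    differences of the k-th power between z + h and z. By sub_exp_bound it is
    dominated by a multiple of the terms at a radius r2 < rho, so that the
    limit h -> 0 is taken term by term. *)
Lemma psum_holomorphic u rho :
  (forall r, 0 <= r -> r < rho -> exists M, pow_bounded u r M) ->
  holomorphic_on (disk rho) (psum u).
Proof.
move=> uR z zD; have zrho : cabs z < rho := zD.
(* z + h stays in the disk of radius r1, and convergence is used at r2. *)
pose r1 := (cabs z + rho) / 2; pose r2 := (r1 + rho) / 2.
have z0 := cabs_ge0 z.
have [zr1 r12 r2rho] : [/\ cabs z < r1, r1 < r2 & r2 < rho] by rewrite /r2 /r1; split; lra.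
have r20 : 0 <= r2 by move: zr1 r12 z0; lra.
have [M uM] := uR _ r20 r2rho.
pose q k (h : C) : C := \sum_(i < k) (h + z) ^+ (k.-1 - i) * z ^+ i.
pose v k : C := (r2 - r1)^-1%:C%C * (u k * r2%:C%C ^+ k).
have vM := abs_bounded_scale ((r2 - r1)^-1%:C%C) uM.
have qv k h : cabs (h + z) <= r1 -> cabs (u k * q k h) <= cabs (v k).
  have i0 : 0 <= (r2 - r1)^-1 by rewrite invr_ge0 subr_ge0 ltW.
  move=> hz; rewrite /v mulrCA !cabsM cabsX (cabs_realge0 i0) (cabs_realge0 r20).
  by rewrite ler_wpM2l ?cabs_ge0 //; apply: sub_exp_bound => //; exact: ltW.
have h0 : (fun h : C => h) @ (0 : C)^' --> (0 : C).
  by apply: cvg_within.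
have near_small : \forall h \near (0 : C)^', cabs (h + z) <= r1.
  have d0 : 0 < r1 - cabs z by rewrite subr_gt0.
  have /cvg_cabsP/(_ _ d0) := h0; apply: filterS => h.
  rewrite sub0r cabsN => hd; apply: le_trans (cabsD _ _) _; lra.
have tan : (fun h => csum (fun k => u k * q k h)) @ (0 : C)^' --> csum (fun k => u k * q k 0).
  apply: (tannery vM).
  - by move: near_small; apply: filterS => h hz k; exact: qv.
  - by move=> k; apply: qv; rewrite add0r ltW.
  - move=> k; apply: cvg_scaleC; apply: cvg_sumC => i; apply: cvg_mulC; last exact: cvg_cst.
    by apply: cvg_expC; apply: (cvg_addC h0); exact: cvg_cst.
apply: (cvgP (csum (fun k => u k * q k 0))).
apply: cvg_trans tan; apply: near_eq_cvg; near=> h.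
have hz : cabs (h + z) <= r1 by near: h.
have hn0 : h != 0 by near: h; exact: nbhs_dnbhs_neq.
have b1 : abs_bounded (fun k => u k * (h + z) ^+ k) M.
  by apply: pow_bounded_le uM => //; lra.
have b2 : abs_bounded (fun k => u k * z ^+ k) M.
  by apply: pow_bounded_le uM => //; lra.
have -> : h^-1 *: ((psum u \o shift z) (h *: 1) - psum u z) =
    h^-1 * (psum u (h + z) - psum u z).
  by rewrite /= [h *: 1]mulr1.
rewrite -(csum_lin (h^-1) b1 b2); congr csum; apply/funext => k.
by rewrite -mulrBr subrXX addrK mulrCA mulKf.
Unshelve. all: by end_near. Qed.

End Disk.

(** * From summable double arrays to convergence in H(D) *)

Section Unconditional.
Variable R : realType.
Local Notation C := (Cplx R).
Implicit Types (u v x : nat -> C) (c : nat -> nat -> C) (M r rho e : R) (z : C).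

Lemma partial_sum_ord (V : zmodType) (y : nat -> V) (J : {fset nat}) N :
  (forall i, i \in J -> (i < N)%N) -> partial_sum y J = \sum_(n < N | (n : nat) \in J) y n.
Proof.
move=> JN; have -> : partial_sum y J = \sum_(i <- J) y i.
  by rewrite /partial_sum -(big_seq_fsetE _ J xpredT y).
rewrite -(big_mkord (fun n => n \in J)) -[RHS]big_filter; apply: perm_big; apply: uniq_perm.
- exact: fset_uniq.
- by rewrite filter_uniq // iota_uniq.
- move=> i; rewrite mem_filter mem_index_iota /=.
  by have [/JN->|] := boolP (i \in J).
Qed.

Lemma fset_nat_bound (J : {fset nat}) : exists N, forall i, i \in J -> (i < N)%N.
Proof. by exists (\max_(i <- J) i).+1 => i iJ; rewrite ltnS; exact: (@leq_bigmax_seq _ _ _ id). Qed.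

Lemma partial_sum_fct (f : nat -> C -> C) (J : {fset nat}) z :
  partial_sum f J z = partial_sum (f^~ z) J.
Proof. by rewrite /partial_sum fct_sumE. Qed.

Lemma near_totally_lt n : \forall J \near totally, forall i, (i < n)%N -> i \in (J : {fset nat}).
Proof.
exists [fset i in iota 0 n]%fset => // J /= /fsubsetP h i il.
by apply: h; rewrite !inE mem_iota.
Qed.

(** If J contains the first n indices, the terms missing from the sum over J
    belong to the tail after n, which v dominates. The bound is uniform in x,
    hence in a point at which functions are evaluated. *)
Lemma csum_partial_sum x v M n e (J : {fset nat}) : abs_bounded v M ->
  (forall k, cabs (x k) <= cabs (v k)) -> M - e < \sum_(k < n) cabs (v k) ->
  (forall i, (i < n)%N -> i \in J) -> cabs (csum x - partial_sum x J) < e.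
Proof.
move=> vM xv hn nJ; apply: le_lt_trans (_ : M - \sum_(k < n) cabs (v k) < _); last by lra.
have [N0 JN0] := fset_nat_bound J.
apply: (cabs_lim_le (f := series x)); first exact: abs_bounded_cvg (abs_bounded_le xv vM).
near=> N.
have JN i : i \in J -> (i < N)%N.
  by move=> /JN0 /leq_trans; apply; near: N; exists N0.
have nN : (n <= N)%N by near: N; exists n.
rewrite seriesE (partial_sum_ord _ JN) (bigID (fun k : 'I_N => (k : nat) \in J)) /= addrAC subrr add0r.
apply: le_trans (cabs_sum _ _ _) _.
apply: (@le_trans _ _ (\sum_(k < N) cabs (v k) - \sum_(k < n) cabs (v k))); last by rewrite lerB.
rewrite (sum_ord_sub (fun k => cabs (v k)) nN) big_geq_mkord [leRHS]big_mkcond [leLHS]big_mkcond /=.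
apply: ler_sum => i _; case: ifPn => [iJ|_]; last by case: ifP => // _; exact: cabs_ge0.
by rewrite leqNgt; have [/nJ iJ'|_] := ltnP i n; [rewrite iJ' in iJ|].
Unshelve. all: by end_near. Qed.

Lemma abs_bounded_totally x M : abs_bounded x M -> partial_sum x @ totally --> csum x.
Proof.
move=> xM; apply/cvg_cabsP => e e0; have [M' [xM' [n hn]]] := abs_bounded_sup xM e0.
by apply: filterS (near_totally_lt n) => J; exact: (csum_partial_sum xM').
Qed.

Lemma csum_norm_le x (a : nat -> R) M : (forall k, cabs (x k) <= a k) ->
  abs_bounded (fun k => (a k)%:C%C) M -> cabs (csum x) <= cabs (csum (fun k => (a k)%:C%C)).
Proof.
move=> xa aM; have a0 k : 0 <= a k by apply: le_trans (xa k); exact: cabs_ge0.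
have xM : abs_bounded x M by apply: abs_bounded_le aM => k; rewrite cabs_realge0.
apply/ler_addgt0Pr => e e0; have e20 : 0 < e / 2 by rewrite divr_gt0.
have /cvg_cabsP/(_ _ e20) ha := abs_bounded_cvg aM.
have /cvg_cabsP/(_ _ e20) hx := abs_bounded_cvg xM.
near \oo => n.
have h1 : cabs (csum x - series x n) < e / 2 by near: n.
have h2 : cabs (csum (fun k => (a k)%:C%C) - series (fun k => (a k)%:C%C) n) < e / 2 by near: n.
have h3 : cabs (series x n) <= cabs (series (fun k => (a k)%:C%C : C) n).
  rewrite !seriesE; apply: le_trans (cabs_sum _ _ _) _.
  rewrite -[X in cabs X](rmorph_sum (real_complex R)) /= cabs_realge0 ?sumr_ge0 //.
  exact: ler_sum.
rewrite cabsB in h2.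
have := cabsD (csum x - series x n) (series x n); rewrite subrK.
have := cabsD (series (fun k => (a k)%:C%C : C) n - csum (fun k => (a k)%:C%C)) (csum (fun k => (a k)%:C%C)).
by rewrite subrK; move: h1 h2 h3; lra.
Unshelve. all: by end_near. Qed.

Lemma rect_bounded_le c d M : (forall n k, cabs (c n k) <= cabs (d n k)) ->
  rect_bounded d M -> rect_bounded c M.
Proof.
move=> cd dM n k; apply: le_trans (dM n k).
by apply: ler_sum => i _; apply: ler_sum => j _.
Qed.

Lemma pow_rect_le c r M z : 0 <= r -> cabs z <= r ->
  rect_bounded (fun n k => c n k * r%:C%C ^+ k) M -> rect_bounded (fun n k => c n k * z ^+ k) M.
Proof.
move=> r0 zr; apply: rect_bounded_le => n k.
by rewrite !cabsM !cabsX cabs_realge0 // ler_wpM2l ?cabs_ge0 // lerXn2r ?nnegrE ?cabs_ge0.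
Qed.

Lemma rect_col_bounded c r M k : 0 < r -> rect_bounded (fun n k => c n k * r%:C%C ^+ k) M ->
  abs_bounded (fun n => c n k) (M / r ^+ k).
Proof.
move=> r0 cM n; have rk : 0 < r ^+ k by rewrite exprn_gt0.
rewrite ler_pdivlMr // mulr_suml.
have := rect_bounded_row k (rect_bounded_swap cM) n; congr (_ <= _).
by apply: eq_bigr => i _; rewrite cabsM cabsX cabs_realge0 // ltW.
Qed.

Lemma columns_bounded c r M z : 0 < r -> cabs z <= r ->
  rect_bounded (fun n k => c n k * r%:C%C ^+ k) M ->
  abs_bounded (fun k => csum (fun n => c n k) * z ^+ k) M.
Proof.
move=> r0 zr cM.
have := rows_bounded (rect_bounded_swap (pow_rect_le (ltW r0) zr cM)).
apply: abs_bounded_le => k.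
by rewrite (csum_mulr (z ^+ k) (rect_col_bounded k r0 cM)).
Qed.

Lemma psum_exchange c r M z : 0 < r -> cabs z <= r ->
  rect_bounded (fun n k => c n k * r%:C%C ^+ k) M ->
  series (fun n => psum (c n) z) @ \oo --> psum (fun k => csum (fun n => c n k)) z.
Proof.
move=> r0 zr cM; have cz := pow_rect_le (ltW r0) zr cM.
have -> : psum (fun k => csum (fun n => c n k)) z =
    csum (fun k => csum (fun n => c n k * z ^+ k)).
  congr csum; apply/funext => k.
  by rewrite (csum_mulr (z ^+ k) (rect_col_bounded k r0 cM)).
exact: csum_exchange cz.
Qed.

(** The Weierstrass test: on a compact set, which lies in a disk of radius r <
    rho, the n-th function is dominated by the n-th row sum at r, and these
    sums form a convergent series. The limit is the power series of the column
    sums. *)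
Lemma unconditional_of_rect_bounded (f : nat -> C -> C) c rho : 0 < rho ->
  (forall n z, cabs z < rho -> f n z = psum (c n) z) ->
  (forall r, 0 < r -> r < rho -> exists M, rect_bounded (fun n k => c n k * r%:C%C ^+ k) M) ->
  unconditionally_convergent_in_H (disk rho) f.
Proof.
move=> rho0 fE cR; exists (psum (fun k => csum (fun n => c n k))).
  apply: psum_holomorphic => r r0 rrho.
  pose r' := (r + rho) / 2.
  have [r'0 rr' r'rho] : [/\ 0 < r', r <= r' & r' < rho] by rewrite /r'; split; lra.
  have [M cM] := cR _ r'0 r'rho; exists M.
  have cr : cabs (r%:C%C : C) <= r' by rewrite cabs_realge0.
  exact: columns_bounded r'0 cr cM.
apply/fam_cvgP => K [cK Krho]; apply/cvg_uniform_onP => e e0.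
have [r [r0 rrho Kr]] := compact_in_disk rho0 cK Krho.
have [M cM] := cR _ r0 rrho.
pose d n k : C := (cabs (c n k * r%:C%C ^+ k))%:C%C.
have dM : rect_bounded d M.
  by apply: rect_bounded_le cM => n k; rewrite /d cabs_realge0 ?cabs_ge0.
have [M' [vM [n hn]]] := abs_bounded_sup (rows_bounded dM) e0.
apply: filterS (near_totally_lt n) => J nJ z Kz.
have zr := Kr z Kz; have zrho := le_lt_trans zr rrho.
rewrite partial_sum_fct -(cvg_csum (psum_exchange r0 zr cM)).
have -> : f^~ z = (fun n => psum (c n) z) by apply/funext => m; rewrite fE.
apply: (csum_partial_sum vM) hn nJ => m.
apply: csum_norm_le (rect_bounded_row m dM) => k.
by rewrite !cabsM !cabsX cabs_realge0 ?(ltW r0) // ler_wpM2l ?cabs_ge0 // lerXn2r ?nnegrE ?cabs_ge0 // ltW.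
Qed.

End Unconditional.

(** * From convergence in H(D) to summable double arrays *)

Section Converse.
Variable R : realType.
Local Notation C := (Cplx R).
Implicit Types (u v x : nat -> C) (c : nat -> nat -> C) (M r rho e : R) (z : C).

Lemma pow_bounded_sum c r (A : nat -> R) N (P : pred nat) : (forall n, pow_bounded (c n) r (A n)) ->
  pow_bounded (fun k => \sum_(n < N | P n) c n k) r (\sum_(n < N | P n) A n).
Proof.
move=> cA K.
apply: (@le_trans _ _ (\sum_(k < K) \sum_(n < N | P n) cabs (c n k * r%:C%C ^+ k))).
  by apply: ler_sum => k _; rewrite mulr_suml; exact: cabs_sum.
by rewrite exchange_big; apply: ler_sum => n _; exact: cA.
Qed.

Lemma psum_sum c r (A : nat -> R) N (P : pred nat) z : 0 <= r -> cabs z <= r ->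
  (forall n, pow_bounded (c n) r (A n)) ->
  psum (fun k => \sum_(n < N | P n) c n k) z = \sum_(n < N | P n) psum (c n) z.
Proof.
move=> r0 zr cA; apply: cvg_csum.
have -> : series (fun k => (\sum_(n < N | P n) c n k) * z ^+ k) =
    (fun K => \sum_(n < N | P n) series (fun k => c n k * z ^+ k) K).
  apply/funext => K; rewrite seriesE; under eq_bigr do rewrite mulr_suml.
  by rewrite exchange_big; apply: eq_bigr => n _; rewrite seriesE.
by apply: cvg_sumC => n; exact: abs_bounded_cvg (pow_bounded_le r0 zr (cA n)).
Qed.

Lemma geometric_sum_le (q : R) K : 0 <= q -> q < 1 -> \sum_(k < K) q ^+ k <= (1 - q)^-1.
Proof.
move=> q0 q1; have h : 0 < 1 - q by rewrite subr_gt0.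
rewrite -[leRHS]mul1r ler_pdivlMr // mulrC -opprB mulNr -subrX1 opprB lerBlDr lerDl exprn_ge0 //.
Qed.

(** Sums over finite sets of indices that contain a suitable J0 stay within 1
    of the limit g on the closed disk. Any other finite sum is a sum over a
    set containing J0 minus a sum over a subset of J0, and the latter are
    bounded since J0 is finite. *)
Lemma uncond_bounded (f : nat -> C -> C) c rho r : 0 < r -> r < rho ->
  (forall n z, cabs z < rho -> f n z = psum (c n) z) ->
  (forall n, exists M, pow_bounded (c n) r M) ->
  unconditionally_convergent_in_H (disk rho) f ->
  exists M, forall N (P : pred nat) z, cabs z = r -> cabs (\sum_(n < N | P n) psum (c n) z) <= M.
Proof.
move=> r0 rrho fE cR [g _ /fam_cvgP fg].
have [A cA] := choice cR.
have A0 n : 0 <= A n by have := cA n 0%N; rewrite big_ord0.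
have {fg} : {uniform [set z | cabs z <= r], partial_sum f @ totally --> g}.
  by apply: fg; split; [exact: compact_closed_disk|move=> z /= zr; exact: le_lt_trans rrho].
move=> /cvg_uniform_onP/(_ _ ltr01)[J0 _ J0g].
have [N0 JN0] := fset_nat_bound J0.
pose B0 := \sum_(n < N0) A n; exists (2 * B0 + 2) => N P z zr.
have psb n : cabs (psum (c n) z) <= A n.
  by apply: csum_bound (pow_bounded_le _ _ (cA n)); rewrite ?zr // ltW.
have fz : f^~ z = (fun n => psum (c n) z) by apply/funext => n; rewrite fE // zr.
pose N' := maxn N N0.
have small (S : pred nat) : (forall n, S n -> n \in J0) ->
    cabs (\sum_(n < N' | S n) psum (c n) z) <= B0.
  move=> SJ; apply: le_trans (cabs_sum _ _ _) _.
  rewrite /B0 (big_ord_widen _ A (leq_maxr N N0)) big_mkcond [leRHS]big_mkcond /=.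
  apply: ler_sum => n _; case: ifPn => [/SJ/JN0 -> //|_]; by case: ifP.
(* Q selects the subsum to bound; J1 is its union with J0. *)
pose Q n := (n < N)%N && P n.
pose J1 : {fset nat} := [fset n in iota 0 N' | Q n || (n \in J0)]%fset.
have J1E n : (n \in J1) = (n < N')%N && (Q n || (n \in J0)) by rewrite !inE mem_iota.
have J0N' n : n \in J0 -> (n < N')%N by move=> /JN0 h; rewrite leq_max h orbT.
have h1 : cabs (g z - \sum_(n < N' | Q n || ((n : nat) \in J0)) psum (c n) z) < 1.
  have : cabs (g z - partial_sum f J1 z) < 1.
    apply: J0g; last by rewrite /= zr.
    by apply/fsubsetP => n nJ; rewrite J1E nJ orbT J0N'.
  rewrite partial_sum_fct fz (@partial_sum_ord _ _ _ N'); last by move=> n; rewrite J1E => /andP[].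
  by congr (cabs (_ - _) < _); apply: eq_bigl => n; rewrite J1E ltn_ord.
have h0 : cabs (g z - \sum_(n < N' | (n : nat) \in J0) psum (c n) z) < 1.
  have : cabs (g z - partial_sum f J0 z) < 1 by apply: J0g; rewrite /= ?zr.
  by rewrite partial_sum_fct fz (partial_sum_ord _ J0N').
have h2 := small (fun n => n \in J0) (fun n h => h).
have h3 := small (fun n => (n \in J0) && ~~ Q n) (fun n h => proj1 (andP h)).
have E : \sum_(n < N' | Q n || ((n : nat) \in J0)) psum (c n) z =
   \sum_(n < N | P n) psum (c n) z + \sum_(n < N' | ((n : nat) \in J0) && ~~ Q n) psum (c n) z.
  rewrite (bigID (fun n : 'I_N' => Q n)) /=; congr (_ + _).
    rewrite (big_ord_widen_cond _ P (fun n => psum (c n) z) (leq_maxl N N0)).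
    by apply: eq_bigl => n; rewrite /Q andbC; case: (_ < _)%N; case: (P _); rewrite ?andbF.
  by apply: eq_bigl => n; case: (Q n); rewrite ?andbF.
rewrite E in h1.
set s := \sum_(n < N | P n) _ in h1 *; set t := \sum_(n < N' | _ && _) _ in h1 h3.
set w := \sum_(n < N' | _) _ in h0 h2.
have -> : s = - (g z - (s + t)) + ((g z - w) + w - t) by ring.
have := cabsD (- (g z - (s + t))) ((g z - w) + w - t).
have := cabsD ((g z - w) + w) (- t); have := cabsD (g z - w) w.
by rewrite !cabsN; move: h0 h1 h2 h3; lra.
Qed.

(** On a circle of radius r' with r < r' < rho all finite subsums of the f_n
    are bounded by one M, so Cauchy's inequality bounds all finite subsums of
    a column k by M / r'^k. Hence the moduli in column k sum up to at most 4 M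
    / r'^k, and the sum over k of these bounds times r^k is geometric. *)
Lemma rect_bounded_of_unconditional (f : nat -> C -> C) c rho :
  (forall n z, cabs z < rho -> f n z = psum (c n) z) ->
  (forall n r, 0 < r -> r < rho -> exists M, pow_bounded (c n) r M) ->
  unconditionally_convergent_in_H (disk rho) f ->
  forall r, 0 < r -> r < rho -> exists M, rect_bounded (fun n k => c n k * r%:C%C ^+ k) M.
Proof.
move=> fE cR unc r r0 rrho; pose r' := (r + rho) / 2.
have [r'0 rr' r'rho] : [/\ 0 < r', r < r' & r' < rho] by rewrite /r'; split; lra.
have cR' n := cR n r' r'0 r'rho.
have [M fM] := uncond_bounded r'0 r'rho fE cR' unc.
have [A cA] := choice cR'.
have M0 : 0 <= M.
  by apply: le_trans (fM 0%N xpredT r'%:C%C _); rewrite ?cabs_ge0 // cabs_realge0 // ltW.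
have cauchy N (P : pred nat) k : cabs (\sum_(n < N | P n) c n k) * r' ^+ k <= M.
  apply: (cauchy_estimate (ltW r'0) (pow_bounded_sum N P cA)) => z zr.
  by rewrite (psum_sum _ _ (ltW r'0) _ cA) ?zr //; exact: fM.
have col N k : \sum_(n < N) cabs (c n k) * r' ^+ k <= 4 * M.
  have := @sum_cabs_le4 _ (fun n => c n k * r'%:C%C ^+ k) M N.
  under eq_bigr do rewrite cabsM cabsX cabs_realge0 ?(ltW r'0) //.
  by apply=> P; rewrite -mulr_suml cabsM cabsX cabs_realge0 ?(ltW r'0).
pose q := r / r'; have q0 : 0 <= q by rewrite divr_ge0 // ltW.
have q1 : q < 1 by rewrite ltr_pdivrMr // mul1r.
exists (4 * M * (1 - q)^-1) => N K; rewrite -rect_swap /rect.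
apply: (@le_trans _ _ (\sum_(k < K) 4 * M * q ^+ k)).
  apply: ler_sum => k _; apply: le_trans (_ : (\sum_(n < N) cabs (c n k) * r' ^+ k) * q ^+ k <= _).
    rewrite mulr_suml; apply: ler_sum => n _.
    rewrite cabsM cabsX cabs_realge0 ?(ltW r0) // -mulrA -exprMn /q mulrCA divff ?mulr1 // gt_eqF //.
  by rewrite ler_wpM2r ?exprn_ge0.
by rewrite -mulr_sumr ler_wpM2l ?geometric_sum_le // mulr_ge0.
Qed.

(** * Division by 1 - z *)

(** The Taylor coefficients of f(z) / (1 - z), when u are those of f. *)
Definition cumul u N : C := \sum_(k < N.+1) u k.

(** Summation by parts for the division by 1 - z, with the remainder that
    vanishes in the limit; for nonnegative a this remainder has the sign
    needed in cumul_bound. *)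
Lemma cumul_real_identity (a : nat -> R) r K :
  (1 - r) * (\sum_(N < K) (\sum_(k < N.+1) a k) * r ^+ N) =
  \sum_(k < K) a k * r ^+ k - r ^+ K * \sum_(k < K) a k.
Proof.
elim: K => [|K IH]; first by rewrite !big_ord0 mulr0 mulr0 subr0.
rewrite [in LHS]big_ord_recr /= mulrDr IH ![\sum_(k < K.+1) _]big_ord_recr /= exprS; ring.
Qed.

Lemma cumul_bound u r K : 0 <= r -> r < 1 ->
  \sum_(N < K) cabs (cumul u N * r%:C%C ^+ N) <=
  (1 - r)^-1 * \sum_(k < K) cabs (u k * r%:C%C ^+ k).
Proof.
move=> r0 r1; have h : 0 < 1 - r by rewrite subr_gt0.
rewrite mulrC ler_pdivlMr // mulrC.
have E (w : nat -> C) : \sum_(k < K) cabs (w k * r%:C%C ^+ k) = \sum_(k < K) cabs (w k) * r ^+ k.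
  by apply: eq_bigr => k _; rewrite cabsM cabsX cabs_realge0.
rewrite !E.
apply: (@le_trans _ _ ((1 - r) * (\sum_(N < K) (\sum_(k < N.+1) cabs (u k)) * r ^+ N))).
  rewrite (ler_wpM2l (ltW h)) //; apply: ler_sum => N _.
  by rewrite ler_wpM2r ?exprn_ge0 //; exact: cabs_sum.
rewrite (cumul_real_identity (fun k => cabs (u k))) lerBlDr lerDl.
by rewrite mulr_ge0 ?exprn_ge0 // sumr_ge0 // => k _; exact: cabs_ge0.
Qed.

Lemma rect_cumul c r M : 0 <= r -> r < 1 ->
  rect_bounded (fun n k => c n k * r%:C%C ^+ k) M ->
  rect_bounded (fun n k => cumul (c n) k * r%:C%C ^+ k) ((1 - r)^-1 * M).
Proof.
move=> r0 r1 cM N K; apply: (@le_trans _ _ ((1 - r)^-1 * rect (fun n k => c n k * r%:C%C ^+ k) N K)).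
  by rewrite /rect mulr_sumr; apply: ler_sum => n _; exact: cumul_bound.
by rewrite ler_wpM2l // invr_ge0 subr_ge0 ltW.
Qed.

Lemma cumulS u N : u N.+1 = cumul u N.+1 - cumul u N.
Proof. by rewrite /cumul [in X in X - _]big_ord_recr /= addrAC subrr add0r. Qed.

Lemma cumul0 u : u 0%N = cumul u 0.
Proof. by rewrite /cumul big_ord1. Qed.

Lemma uncumul_bound u r K : 0 <= r ->
  \sum_(k < K) cabs (u k * r%:C%C ^+ k) <=
  (1 + r) * \sum_(N < K) cabs (cumul u N * r%:C%C ^+ N).
Proof.
move=> r0; have U0 : 0 <= \sum_(N < K) cabs (cumul u N * r%:C%C ^+ N).
  by apply: sumr_ge0 => N _; exact: cabs_ge0.
case: K U0 => [|K] U0; first by rewrite !big_ord0 mulr0.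
rewrite big_ord_recl /= mulrDl mul1r [X in _ <= X + _]big_ord_recl /= -addrA cumul0 lerD //.
apply: (@le_trans _ _ (\sum_(k < K) (cabs (cumul u k.+1 * r%:C%C ^+ k.+1) + r * cabs (cumul u k * r%:C%C ^+ k)))).
  apply: ler_sum => k _; rewrite /bump /= add1n cumulS mulrBl; apply: le_trans (cabsD _ _) _.
  by rewrite cabsN lerD // exprS mulrCA [X in X <= _]cabsM cabs_realge0.
rewrite big_split /= -mulr_sumr lerD // ler_wpM2l // big_ord_recr /= lerDl; exact: cabs_ge0.
Qed.

Lemma rect_uncumul c r M : 0 <= r ->
  rect_bounded (fun n k => cumul (c n) k * r%:C%C ^+ k) M ->
  rect_bounded (fun n k => c n k * r%:C%C ^+ k) ((1 + r) * M).
Proof.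
move=> r0 cM N K.
apply: (@le_trans _ _ ((1 + r) * rect (fun n k => cumul (c n) k * r%:C%C ^+ k) N K)).
  by rewrite /rect mulr_sumr; apply: ler_sum => n _; exact: uncumul_bound.
by rewrite ler_wpM2l // addr_ge0.
Qed.

(** The partial sums satisfy the identity f = U - z U up to a shift of the
    summation range, U being the quotient of f by 1 - z; in the limit the
    shift disappears. *)
Lemma cumul_csum u M z : abs_bounded (fun k => cumul u k * z ^+ k) M ->
  series (fun k => u k * z ^+ k) @ \oo --> ((1 - z) * psum (cumul u) z : C).
Proof.
move=> uM; have cv := abs_bounded_cvg uM.
rewrite -(cvg_shiftS (series (fun k => u k * z ^+ k))).
have -> : (1 - z) * psum (cumul u) z = psum (cumul u) z + (- z) * psum (cumul u) z by ring.
have E n : series (fun k => u k * z ^+ k) n.+1 = series (fun k => cumul u k * z ^+ k) n.+1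
    + (- z) * series (fun k => cumul u k * z ^+ k) n.
  rewrite !seriesE; elim: n => [|n IH].
    by rewrite !big_ord1 big_ord0 mulr0 addr0 cumul0.
  rewrite big_ord_recr /= IH [in RHS]big_ord_recr /= [X in _ = _ + _ * X]big_ord_recr /=.
  by rewrite cumulS exprS; ring.
under eq_fun do rewrite E.
by apply: cvg_addC; [rewrite (cvg_shiftS (series _))|exact: cvg_scaleC].
Qed.

End Converse.

(** * Words, harmonic sums and Taylor coefficients of polylogarithms *)

Section Words.

Implicit Types (v : seq letterY) (s : letterY) (n N k : nat).

Lemma encode_cons s v : encode (s :: v) = nseq (sval s).-1 x0 ++ x1 :: encode v.
Proof. by rewrite /encode /= cat_rcons. Qed.

Lemma nseq_x0_inj m n (t t' : seq letterX) :
  nseq m x0 ++ x1 :: t = nseq n x0 ++ x1 :: t' -> m = n /\ t = t'.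
Proof.
elim: m n => [|m IH] [|n] //=; first by case=> ->.
by case=> /IH[-> ->].
Qed.

Lemma encode_inj : injective encode.
Proof.
elim=> [|s v IH] [|s' v']; rewrite ?encode_cons //; try by case: (_.-1).
move=> /nseq_x0_inj[ss /IH ->]; congr (_ :: _); apply: val_inj => /=.
by case: s s' ss => [[|m] ?] [[|m'] ?] //= ->.
Qed.

Lemma size_encode v : size (encode v) = weight v.
Proof.
elim: v => [|s v IH]; first by rewrite /weight big_nil.
rewrite encode_cons size_cat /= IH size_nseq /weight big_cons.
by case: s => [[|m] ?] //=; rewrite addnS.
Qed.

Lemma encode_ends_in_x1 v : encode v = [::] \/ exists u, encode v = rcons u x1.
Proof.
elim: v => [|s v IH]; [by left|right]; rewrite encode_cons.
case: IH => [->|[u ->]]; first by exists (nseq (sval s).-1 x0); rewrite cats1.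
by exists (nseq (sval s).-1 x0 ++ x1 :: u); rewrite rcons_cat.
Qed.

Lemma finite_seq_size (T : finType) n : finite_set [set w : seq T | size w = n].
Proof.
apply: (@sub_finite_set _ _ ((@tval n T) @` setT)); last exact/finite_image/finite_finset.
by move=> w /= wn; exists (tcast wn (in_tuple w)) => //; rewrite val_tcast.
Qed.

Lemma finite_weight n : finite_set [set v | weight v = n].
Proof.
apply: (@sub_finite_set _ _ (encode @^-1` [set w : seq bool | size w = n])).
  by move=> v /= <-; rewrite size_encode.
by apply: finite_preimage; [move=> ? ? _ _; exact: encode_inj|exact: (finite_seq_size bool)].
Qed.

Definition words_of_weight n : seq (seq letterY) := fset_set [set v | weight v = n].

(** Only finitely many words have weight n, so the sums over all words that
    define the linear extensions to polynomials are finite sums. *)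
Lemma fsbig_weight (V : nmodType) n (g : seq letterY -> V) : (forall v, weight v != n -> g v = 0) ->
  \sum_(v \in [set: seq letterY]) g v = \sum_(v <- words_of_weight n) g v.
Proof.
move=> g0; rewrite -(fsbig_widen [set v | weight v = n] setT) //.
  by rewrite fsbig_finite //; exact: finite_weight.
by move=> v /= [_ /eqP vn]; exact: g0.
Qed.

Lemma finite_bounded_seq n N :
  finite_set [set t : seq nat | size t = n /\ all (fun i => (i <= N)%N) t].
Proof.
elim: n => [|n IH].
  by apply: (@sub_finite_set _ _ [set [::]]) => // -[|? ?] [].
apply: (@sub_finite_set _ _ ((fun p => p.1 :: p.2) @` (`I_N.+1 `*`
   [set t : seq nat | size t = n /\ all (fun i => (i <= N)%N) t]))).
  by move=> [|a t] /= [] // [tn] /andP[aN tN]; exists (a, t).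
by apply: finite_image; apply: finite_setX.
Qed.

(** The indices decrease, so the first one bounds them all. *)
Lemma decreasing_bounded v t N : decreasing_indices v t -> (head 0%N t <= N)%N ->
  all (fun i => (i <= N)%N) t.
Proof.
case: t => [|a t] //= [_ /=].
rewrite rcons_path => /andP[pt _] aN; rewrite aN /=.
have := order_path_min (rev_trans ltn_trans) pt.
by apply: sub_all => i /= ia; apply: leq_trans aN; exact: ltnW.
Qed.

Lemma finite_decreasing v N :
  finite_set [set t | decreasing_indices v t /\ (head 0%N t <= N)%N].
Proof.
apply: sub_finite_set (finite_bounded_seq (size v) N) => t [tv tN]; split.
  by case: tv.
exact: decreasing_bounded tv tN.
Qed.

Lemma finite_decreasing_eq v N :
  finite_set [set t | decreasing_indices v t /\ head 0%N t = N].
Proof. by apply: sub_finite_set (finite_decreasing v N) => t [tv tN]; split; rewrite ?tN. Qed.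

Lemma decreasing_cons s v a t :
  decreasing_indices (s :: v) (a :: t) <->
  (0 < a)%N /\ decreasing_indices v t /\ (head 0%N t < a)%N.
Proof.
rewrite /decreasing_indices /=; split.
  move=> [[tv]]; case: t tv => [|b t] /= tv; first by rewrite andbT => ->.
  by move=> /andP[ba pt]; rewrite (leq_ltn_trans _ ba).
by move=> [a0 [[tv st] ta]]; split; [rewrite tv|case: t tv st ta => [|b t] /= _ st ta; rewrite ?a0 ?ta].
Qed.

End Words.

Section Coefficients.
Variable R : realType.
Local Notation C := (Cplx R).
Implicit Types (v : seq letterY) (s : letterY) (n N k : nat).

Lemma Li_word_coef_nil N : Li_word_coef R [::] N = (N == 0%N)%:R.
Proof.
rewrite /Li_word_coef; case: N => [|N].
  rewrite (_ : [set t | _] = [set [::]]); first by rewrite fsbig_set1 /mz_term big_nil.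
  by apply/seteqP; split=> [[|? ?] [[]]|_ ->].
rewrite (_ : [set t | _] = set0) ?fsbig_set0 //.
by apply/seteqP; split=> // -[|? ?] [[]].
Qed.

Lemma Li_word_coef_cons0 s v : Li_word_coef R (s :: v) 0 = 0.
Proof.
rewrite /Li_word_coef (_ : [set t | _] = set0) ?fsbig_set0 //.
apply/seteqP; split=> // -[|a t] []; first by case.
by move=> /decreasing_cons[a0 _] /= a00; rewrite a00 in a0.
Qed.

(** The largest index is fixed to be k + 1, and the others range over the
    index set of a harmonic sum with bound k. *)
Lemma Li_word_coef_consS s v k :
  Li_word_coef R (s :: v) k.+1 = (k.+1%:R ^+ sval s)^-1 * H_word R v k.
Proof.
rewrite /Li_word_coef /H_word mulr_fsumr.
rewrite (_ : [set t | _] = (cons k.+1) @` [set t | decreasing_indices v t /\ (head 0%N t <= k)%N]); last first.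
  apply/seteqP; split=> [[|a t]|_ [t [tv tk] <-]] /=.
  - by case=> -[].
  - by move=> [/decreasing_cons[a0 [tv ta]] ak]; exists t; rewrite -?ak //; split=> //; rewrite -ltnS -ak.
  - by split=> //; apply/decreasing_cons; rewrite ltnS.
rewrite fsbig_image; last by move=> ? ? _ _ [].
by apply: eq_fsbigr => t _; rewrite /mz_term /= big_cons.
Qed.

(** The index tuples of the harmonic sum are sorted by their largest entry. *)
Lemma H_wordE v N : H_word R v N = cumul (Li_word_coef R v) N.
Proof.
elim: N => [|N IH].
  rewrite /cumul big_ord1 /H_word /Li_word_coef.
  suff -> : [set t | decreasing_indices v t /\ (head 0%N t <= 0)%N] =
      [set t | decreasing_indices v t /\ head 0%N t = 0%N] by [].
  by apply/seteqP; split=> t [tv t0]; split=> //; [apply/eqP; rewrite -leqn0|rewrite t0].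
have -> : cumul (Li_word_coef R v) N.+1 = cumul (Li_word_coef R v) N + Li_word_coef R v N.+1.
  by rewrite /cumul big_ord_recr.
rewrite -IH /H_word /Li_word_coef.
rewrite -fsbigU0; [|exact: finite_decreasing|exact: finite_decreasing_eq|].
  suff -> : [set t | decreasing_indices v t /\ (head 0%N t <= N.+1)%N] =
     [set t | decreasing_indices v t /\ (head 0%N t <= N)%N] `|`
     [set t | decreasing_indices v t /\ head 0%N t = N.+1] by [].
  apply/seteqP; split=> t /=.
    by rewrite leq_eqVlt => -[tv /orP[/eqP|]] h; [right|left].
  by case=> -[tv h]; split=> //; [exact: leq_trans h _|rewrite h].
by move=> t [[_ h] [_ h']]; rewrite h' ltnn in h.
Qed.

(** Adding a letter y_s in front sums the coefficients, shifts them by one and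
    divides the k-th one by k^s; only the summation increases the bound, by
    the factor 1 / (1 - r). *)
Lemma Li_word_coef_bounded v (r : R) : 0 <= r -> r < 1 ->
  exists M, pow_bounded (Li_word_coef R v) r M.
Proof.
move=> r0 r1; elim: v => [|s v [M vM]].
  exists 1; case=> [|n]; first by rewrite big_ord0.
  rewrite big_ord_recl big1 => [|i _]; first by rewrite addr0 Li_word_coef_nil mulr1 cabs1.
  by rewrite Li_word_coef_nil mul0r cabs0.
exists ((1 - r)^-1 * M); case=> [|n].
  by rewrite big_ord0 mulr_ge0 ?invr_ge0 ?subr_ge0 ?(ltW r1) //; have := vM 0%N; rewrite big_ord0.
rewrite big_ord_recl Li_word_coef_cons0 mul0r cabs0 add0r.
apply: (@le_trans _ _ (\sum_(k < n) cabs (cumul (Li_word_coef R v) k * r%:C%C ^+ k))).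
  apply: ler_sum => k _; rewrite /bump /= ?add1n Li_word_coef_consS H_wordE !cabsM !cabsX cabsV cabsX.
  rewrite cabs_realge0 // cabs_nat exprS mulrA ler_wpM2r ?exprn_ge0 // -mulrA mulrCA.
  rewrite ler_piMr ?cabs_ge0 // mulr_ile1 ?invr_ge0 ?exprn_ge0 ?ler0n ?(ltW r1) //.
  by rewrite invf_le1 ?exprn_gt0 ?ltr0n // exprn_ege1 // ler1n.
apply: le_trans (cumul_bound _ _ r0 r1) _.
by rewrite ler_wpM2l ?invr_ge0 ?subr_ge0 ?(ltW r1).
Qed.

Lemma Li_poly_coefE n (P : ncseries R letterX) k :
  (forall w, size w != n -> P w = 0) ->
  Li_poly_coef P k = \sum_(v <- words_of_weight n) P (encode v) * Li_word_coef R v k.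
Proof.
by move=> Pn; apply: fsbig_weight => v vn; rewrite Pn ?size_encode // mul0r.
Qed.

(** The harmonic sums of a homogeneous polynomial are the Taylor coefficients
    of its polylogarithm divided by 1 - z; this identity links the two sides
    of the theorem. *)
Lemma H_polyE n (P : ncseries R letterX) N :
  (forall w, size w != n -> P w = 0) ->
  H_poly (piY P) N = cumul (Li_poly_coef P) N.
Proof.
move=> Pn; rewrite /H_poly (@fsbig_weight _ n); last first.
  by move=> v vn; rewrite /piY Pn ?size_encode // mul0r.
rewrite /cumul; under [RHS]eq_bigr do rewrite (Li_poly_coefE _ Pn).
by rewrite exchange_big; apply: eq_bigr => v _; rewrite H_wordE /cumul mulr_sumr.
Qed.

Lemma Li_poly_coef_bounded n (P : ncseries R letterX) (r : R) :
  (forall w, size w != n -> P w = 0) -> 0 <= r -> r < 1 ->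
  exists M, pow_bounded (Li_poly_coef P) r M.
Proof.
move=> Pn r0 r1; have [A LA] := choice (fun v => Li_word_coef_bounded v r0 r1).
exists (\sum_(v <- words_of_weight n) cabs (P (encode v)) * A v) => K.
apply: (@le_trans _ _ (\sum_(k < K) \sum_(v <- words_of_weight n)
    cabs (P (encode v)) * cabs (Li_word_coef R v k * r%:C%C ^+ k))).
  apply: ler_sum => k _; rewrite (Li_poly_coefE _ Pn) mulr_suml; apply: le_trans (cabs_sum _ _ _) _.
  by apply: ler_sum => v _; rewrite -mulrA cabsM.
rewrite exchange_big; apply: ler_sum => v _; rewrite -mulr_sumr ler_wpM2l ?cabs_ge0 //.
exact: LA.
Qed.

Lemma Li_polyE n (P : ncseries R letterX) (z : C) :
  (forall w, size w != n -> P w = 0) -> cabs z < 1 ->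
  Li_poly P z = psum (Li_poly_coef P) z.
Proof.
move=> Pn z1; apply/esym/cvg_csum.
rewrite /Li_poly (@fsbig_weight _ n); last first.
  by move=> v vn; rewrite Pn ?size_encode // mul0r.
have -> : series (fun k => Li_poly_coef P k * z ^+ k) =
  (fun K => \sum_(v <- words_of_weight n) P (encode v) * series (fun k => Li_word_coef R v k * z ^+ k) K).
  apply/funext => K; rewrite seriesE; under eq_bigr do rewrite (Li_poly_coefE _ Pn) mulr_suml.
  rewrite exchange_big; apply: eq_bigr => v _; rewrite seriesE mulr_sumr.
  by apply: eq_bigr => k _; rewrite mulrA.
apply: cvg_sumC => v; apply: cvg_scaleC.
have [M vM] := Li_word_coef_bounded v (cabs_ge0 z) z1.
exact: abs_bounded_cvg (pow_bounded_le (cabs_ge0 z) (lexx _) vM).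
Qed.

Lemma length_part_size n (S : ncseries R letterX) w : size w != n -> length_part n S w = 0.
Proof. by rewrite /length_part => /negPf ->. Qed.

Lemma piX_encode (Q : ncseries R letterY) v : piX Q (encode v) = Q v.
Proof.
rewrite /piX (_ : [set v' | _] = [set v]) ?fsbig_set1 //.
by apply/seteqP; split=> [v' /= /encode_inj|_ ->].
Qed.

Lemma piX_notin (Q : ncseries R letterY) w : (forall v, encode v <> w) -> piX Q w = 0.
Proof.
by move=> h; rewrite /piX (_ : [set v' | _] = set0) ?fsbig_set0 //; apply/seteqP; split=> // v /h.
Qed.

Lemma piX_ends_in_x1 (Q : ncseries R letterY) : ends_in_x1 (piX Q).
Proof.
move=> w; have [[v <-] _|h] := pselect (exists v, encode v = w); first exact: encode_ends_in_x1.
by rewrite piX_notin ?eqxx // => v vw; apply: h; exists v.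
Qed.

Lemma piX_weight_part n (Q : ncseries R letterY) : piX (weight_part n Q) = length_part n (piX Q).
Proof.
apply/funext => w; rewrite /length_part.
have [[v <-]|h] := pselect (exists v, encode v = w).
  by rewrite !piX_encode size_encode.
have hw v : encode v <> w by move=> vw; apply: h; exists v.
by rewrite !(piX_notin _ hw) if_same.
Qed.

Lemma piX_K (Q : ncseries R letterY) : piY (piX Q) = Q.
Proof. by apply/funext => v; rewrite /piY piX_encode. Qed.

End Coefficients.

(** * Harmonic sums of the series in the domain of Li *)

Section DirectAndConverse.
Variable R : realType.
Local Notation C := (Cplx R).
Implicit Types (u v : nat -> C) (c : nat -> nat -> C) (M r rho e : R) (z : C).

(** The terms of a convergent series are bounded, so the power series
    converges absolutely on a smaller circle; its sum is 0 there, and Cauchy's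
    inequality applies with the bound 0. *)
Lemma pseries_zero u rho : 0 < rho ->
  (forall z, cabs z < rho -> series (fun k => u k * z ^+ k) @ \oo --> (0 : C)) ->
  forall k, u k = 0.
Proof.
move=> rho0 u0 k; pose r := rho / 2; have r0 : 0 < r by rewrite divr_gt0.
have rrho : r < rho by rewrite ltr_pdivrMr // ltr_pMr // ltr1n.
pose t n := u n * (r%:C%C : C) ^+ n.
have [B tB] : exists B, forall n, cabs (t n) <= B.
  have ur := u0 r%:C%C; rewrite cabs_realge0 ?(ltW r0) // in ur.
  have /cvg_cabsP/(_ _ ltr01)[n0 _ hn0] := ur rrho.
  exists (2 + \sum_(n < n0) cabs (t n)) => n.
  have S0 : 0 <= \sum_(n < n0) cabs (t n) by apply: sumr_ge0 => i _; exact: cabs_ge0.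
  have [nn0|n0n] := ltnP n n0.
    rewrite (bigD1 (Ordinal nn0)) //= addrCA lerDl addr_ge0 //.
    by apply: sumr_ge0 => i _; exact: cabs_ge0.
  have h1 := hn0 n n0n; have h2 := hn0 n.+1 (leqW n0n).
  rewrite /= !sub0r !cabsN !seriesE big_ord_recr /= in h1 h2.
  (* Two consecutive partial sums within 1 of the limit differ by less than 2.
      *)
  have := cabsD (\sum_(i < n) t i + t n) (- \sum_(i < n) t i).
  by rewrite cabsN addrAC subrr add0r; move: h1 h2 S0; rewrite /t; lra.
pose q := r / 2; have q0 : 0 < q by rewrite divr_gt0.
have qr : q < r by rewrite ltr_pdivrMr // ltr_pMr // ltr1n.
have uM : pow_bounded u q (B * (1 - 2^-1)^-1).
  have B0 : 0 <= B by apply: le_trans (tB 0%N); exact: cabs_ge0.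
  move=> n; apply: (@le_trans _ _ (B * \sum_(k < n) 2^-1 ^+ k)); last first.
    by rewrite ler_wpM2l // geometric_sum_le // invf_lt1 // ltr1n.
  rewrite mulr_sumr; apply: ler_sum => i _.
  rewrite cabsM cabsX cabs_realge0 ?(ltW q0) // /q exprMn mulrA ler_wpM2r ?exprn_ge0 //.
  by have := tB i; rewrite /t cabsM cabsX cabs_realge0 ?(ltW r0).
have := cauchy_estimate (ltW q0) uM (M := 0).
move=> /(_ _ k) h; apply: cabs0_eq0; apply/eqP; rewrite eq_le cabs_ge0 andbT.
rewrite -(@pmulr_lle0 _ (q ^+ k)) ?exprn_gt0 //.
apply: h => z zq; rewrite /psum (cvg_csum (u0 z _)) ?cabs0 // zq.
exact: lt_trans rrho.
Qed.

Section Columns.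
Variables (c : nat -> nat -> C) (r M : R).
Hypotheses (r0 : 0 < r).
Hypothesis cM : rect_bounded (fun n k => cumul (c n) k * r%:C%C ^+ k) M.

(** The Taylor coefficients of the sum over n of f_n(z) / (1 - z), where f_n
    has coefficients c n. *)
Definition col_sum N : C := csum (fun n => cumul (c n) N).

Lemma rows_cvg z n : cabs z <= r ->
  series (fun k => c n k * z ^+ k) @ \oo --> (psum (c n) z : C).
Proof.
move=> zr; apply: abs_bounded_cvg.
exact: rect_bounded_row n (pow_rect_le (ltW r0) zr (rect_uncumul (ltW r0) cM)).
Qed.

Lemma psum_cumul z n : cabs z <= r -> psum (c n) z = (1 - z) * psum (cumul (c n)) z.
Proof.
move=> zr; apply: cvg_csum; apply: cumul_csum.
exact: rect_bounded_row n (pow_rect_le (ltW r0) zr cM).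
Qed.

Lemma col_sum_cvg z : cabs z <= r ->
  series (fun N => col_sum N * z ^+ N) @ \oo --> (psum col_sum z : C).
Proof.
by move=> zr; exact: abs_bounded_cvg (columns_bounded r0 zr cM).
Qed.

(** The rows divided by 1 - z can be summed by columns. *)
Lemma rows_sum_cvg z : cabs z <= r ->
  series (fun n => psum (c n) z) @ \oo --> ((1 - z) * psum col_sum z : C).
Proof.
move=> zr.
have -> : series (fun n => psum (c n) z) = (fun n => (1 - z) * series (fun n => psum (cumul (c n)) z) n).
  by apply/funext => n; rewrite !seriesE mulr_sumr; apply: eq_bigr => i _; rewrite psum_cumul.
by apply: cvg_scaleC; exact: psum_exchange r0 zr cM.
Qed.

End Columns.

Lemma one_sub_neq0 z : z != 1 -> 1 - z != 0.
Proof. by rewrite subr_eq0 eq_sym. Qed.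

Lemma cabs_lt1_neq1 z : cabs z < 1 -> z != 1.
Proof. by apply: contraTneq => ->; rewrite cabs1 ltxx. Qed.

Section Direct.
Variables (rho : R) (S : ncseries R letterX).
Hypotheses (rho0 : 0 < rho) (rho1 : rho <= 1) (domS : Dom_Li rho S).

Let c n := Li_poly_coef (length_part n S).

Let Li_poly_length_part n z : cabs z < rho -> Li_poly (length_part n S) z = psum (c n) z.
Proof.
move=> zrho; apply: (@Li_polyE _ n); first exact: length_part_size.
exact: lt_le_trans zrho rho1.
Qed.

Lemma H_poly_length_part n N : H_poly (piY (length_part n S)) N = cumul (c n) N.
Proof. by apply: (@H_polyE _ n); exact: length_part_size. Qed.

(** This is where the convergence in H(D) is used; rho <= 1 makes the division
    by 1 - z harmless. *)
Lemma Dom_rect r : 0 < r -> r < rho ->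
  exists M, rect_bounded (fun n k => cumul (c n) k * r%:C%C ^+ k) M.
Proof.
move=> r0 rrho.
have [M cM] : exists M, rect_bounded (fun n k => c n k * r%:C%C ^+ k) M.
  apply: (@rect_bounded_of_unconditional _ (fun n => Li_poly (length_part n S)) c rho) => //; last by case: domS.
  move=> n q q0 qrho; apply: (@Li_poly_coef_bounded _ n); [exact: length_part_size|exact: ltW|].
  exact: lt_le_trans rho1.
exists ((1 - r)^-1 * M); apply: rect_cumul => //; [exact: ltW|exact: lt_le_trans rho1].
Qed.

Lemma Dom_H z : cabs z < rho ->
  series (fun N => col_sum c N * z ^+ N) @ \oo --> (Li_series S z / (1 - z) : C).
Proof.
move=> zrho; pose r := (cabs z + rho) / 2; have z0 := cabs_ge0 z.
have [r0 zr rrho] : [/\ 0 < r, cabs z <= r & r < rho].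
  by move: rho0; rewrite /r; split; lra.
have [M cM] := Dom_rect r0 rrho.
have z1 : 1 - z != 0 by apply/one_sub_neq0/cabs_lt1_neq1; exact: lt_le_trans rho1.
have -> : Li_series S z = (1 - z) * psum (col_sum c) z.
  rewrite -(cvg_csum (rows_sum_cvg r0 cM zr)); congr csum.
  by apply/funext => n; exact: Li_poly_length_part.
by rewrite mulrC mulKf //; exact: (col_sum_cvg r0 cM zr).
Qed.

Lemma Dom_H_unique (h : nat -> C) : is_H_of_series rho S h -> h = col_sum c.
Proof.
move=> hS; apply/funext => N; apply/eqP; rewrite -subr_eq0; apply/eqP.
apply: (pseries_zero (u := fun N => h N - col_sum c N) rho0) => z zrho.
have -> : (0 : C) = Li_series S z / (1 - z) + (-1) * (Li_series S z / (1 - z)).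
  by rewrite mulN1r subrr.
have -> : series (fun N => (h N - col_sum c N) * z ^+ N) = (fun n =>
    series (fun N => h N * z ^+ N) n + (-1) * series (fun N => col_sum c N * z ^+ N) n).
  apply/funext => n; rewrite !seriesE mulr_sumr -big_split.
  by apply: eq_bigr => i _; rewrite /= mulN1r mulrBl.
by apply: cvg_addC; [exact: hS|apply: cvg_scaleC; exact: Dom_H].
Qed.

Lemma Dom_Li_harmonic_sums :
  (exists! h : nat -> C, is_H_of_series rho S h) /\
    (forall h : nat -> C, is_H_of_series rho S h ->
      (forall r : R, 0 < r -> r < rho ->
        (\esum_(p in [set: nat * nat])
          (cabs (H_poly (piY (length_part p.1 S)) p.2 * r%:C%C ^+ p.2))%:E < +oo)%E) /\
      (forall N : nat,
        (\esum_(n in [set: nat])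
          (cabs (H_poly (piY (length_part n S)) N))%:E < +oo)%E /\
        series (fun n => H_poly (piY (length_part n S)) N) @ \oo --> h N)).
Proof.
split.
  exists (col_sum c); split; first exact: Dom_H.
  by move=> h /Dom_H_unique ->.
move=> h /Dom_H_unique ->; split=> [r r0 rrho|N].
  apply/(esum_rect (fun n k => H_poly (piY (length_part n S)) k * r%:C%C ^+ k)).
  have [M cM] := Dom_rect r0 rrho; exists M.
  by apply: rect_bounded_le cM => n k; rewrite H_poly_length_part.
have r0 : 0 < rho / 2 by rewrite divr_gt0.
have rrho : rho / 2 < rho by rewrite ltr_pdivrMr // ltr_pMr // ltr1n.
have [M cM] := Dom_rect r0 rrho.
have hM := rect_col_bounded N r0 cM.
have hE : (fun n => H_poly (piY (length_part n S)) N) = (fun n => cumul (c n) N).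
  by apply/funext => n; exact: H_poly_length_part.
split; last by rewrite hE; exact: abs_bounded_cvg hM.
apply/(esum_abs (fun n => H_poly (piY (length_part n S)) N)).
by rewrite hE; eexists; exact: hM.
Qed.

End Direct.

(** The hypothesis is absolute convergence of the double series at the radius
    r itself. Multiplication by 1 - z transfers it to the Taylor coefficients
    of the polylogarithms, and the exchange of summations is then valid on the
    closed disk. *)
Lemma harmonic_sums_Dom_Li (Q : ncseries R letterY) r : 0 < r -> r <= 1 ->
    (\esum_(p in [set: nat * nat])
      (cabs (H_poly (weight_part p.1 Q) p.2 * r%:C%C ^+ p.2))%:E < +oo)%E ->
    exists l : nat -> C,
      [/\ (forall N : nat,
             partial_sum (fun n => H_poly (weight_part n Q) N) @ totally --> l N),
          Dom_Li r (piX Q),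
          (forall z, cabs z < r ->
             series (fun N => l N * z ^+ N) @ \oo -->
               (Li_series (piX Q) z / (1 - z) : C)) &
          (forall z, cabs z <= r -> z != 1 ->
             exists (L : nat -> C) (Lsum : C),
               [/\ (forall n : nat,
                      series (fun N => Li_poly_coef (piX (weight_part n Q)) N * z ^+ N)
                        @ \oo --> L n),
                   series L @ \oo --> Lsum &
                   series (fun N => l N * z ^+ N) @ \oo --> (Lsum / (1 - z) : C)])].
Proof.
move=> r0 r1.
move/(esum_rect (fun n k => H_poly (weight_part n Q) k * r%:C%C ^+ k)) => [M HM].
pose c n := Li_poly_coef (piX (weight_part n Q)).
have partsz n w : size w != n -> piX (weight_part n Q) w = 0.
  by rewrite piX_weight_part; exact: length_part_size.
have HE n N : H_poly (weight_part n Q) N = cumul (c n) N.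
  by rewrite -[weight_part n Q in LHS]piX_K (H_polyE N (partsz n)).
have cM : rect_bounded (fun n k => cumul (c n) k * r%:C%C ^+ k) M.
  by apply: rect_bounded_le HM => n k; rewrite HE.
have LE n z : cabs z < r -> Li_poly (length_part n (piX Q)) z = psum (c n) z.
  move=> zr; rewrite -piX_weight_part; apply: Li_polyE (partsz n) _.
  exact: lt_le_trans r1.
exists (col_sum c); split.
- move=> N; have -> : (fun n => H_poly (weight_part n Q) N) = (fun n => cumul (c n) N).
    by apply/funext => n; exact: HE.
  exact: abs_bounded_totally (rect_col_bounded N r0 cM).
- split; first exact: piX_ends_in_x1.
  apply: (unconditional_of_rect_bounded r0 LE) => q q0 qr; exists ((1 + r) * M).
  apply: (pow_rect_le (ltW r0)); last exact: rect_uncumul (ltW r0) cM.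
  by rewrite cabs_realge0 ?ltW.
- move=> z zr; have zr' := ltW zr.
  have z1 : 1 - z != 0 by apply/one_sub_neq0/cabs_lt1_neq1; exact: lt_le_trans r1.
  have -> : Li_series (piX Q) z = (1 - z) * psum (col_sum c) z.
    rewrite -(cvg_csum (rows_sum_cvg r0 cM zr')); congr csum.
    by apply/funext => n; exact: LE.
  by rewrite mulrC mulKf //; exact: (col_sum_cvg r0 cM zr').
- move=> z zr z1; exists (fun n => psum (c n) z), ((1 - z) * psum (col_sum c) z); split.
  + by move=> n; exact: rows_cvg r0 cM _ _ zr.
  + exact: rows_sum_cvg r0 cM _ zr.
  + by rewrite mulrC mulKf ?one_sub_neq0 //; exact: (col_sum_cvg r0 cM zr).
Qed.

End DirectAndConverse.

(** * Substituting -log(1-z) into exponential generating functions *)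

Section Stirling.

(** The product of exponential generating functions. *)
Definition bconv (K : comNzRingType) (f g : nat -> K) n : K :=
  \sum_(i < n.+1) 'C(n, i)%:R * (f i * g (n - i)%N).

(** Shifting a sequence differentiates its exponential generating function, so
    this is Leibniz' rule; on coefficients it is Pascal's rule. *)
Lemma bconv_leibniz (K : comNzRingType) (f g : nat -> K) n :
  bconv f g n.+1 = bconv (fun i => f i.+1) g n + bconv f (fun i => g i.+1) n.
Proof.
have E : bconv f (fun i => g i.+1) n =
    f 0%N * g n.+1 + \sum_(i < n.+1) 'C(n, i.+1)%:R * (f i.+1 * g (n - i)%N).
  rewrite /bconv big_ord_recl [in RHS]big_ord_recr /= bin0 subn0 mul1r bin_small // mul0r addr0.
  by congr (_ + _); apply: eq_bigr => i _; rewrite /bump /= ?add1n subnSK.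
rewrite E addrCA /bconv big_ord_recl /= bin0 subn0 mul1r; congr (_ + _).
rewrite -big_split; apply: eq_bigr => i _ /=.
by rewrite /bump /= ?add1n subSS binS natrD addrC mulrDl.
Qed.

(** The coefficient of z^k in (-log(1-z))^n / n!. The recurrence integrates
    the relation that the derivative of the (n+1)-st of these functions is the
    n-th one divided by 1 - z. *)
Fixpoint log_coef (K : fieldType) n : nat -> K :=
  if n is n'.+1 then
    fun k => if k is k'.+1 then k'.+1%:R^-1 * \sum_(j < k'.+1) log_coef K n' j else 0
  else fun k => (k == 0%N)%:R.

Lemma log_coef_small (K : fieldType) n k : (k < n)%N -> log_coef K n k = 0.
Proof.
elim: n k => // n IH [|k] //= kn; rewrite big1 ?mulr0 // => j _.
by apply: IH; apply: leq_trans (ltn_ord j) _.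
Qed.

(** The coefficient of z^k in (1 - z) g' = h, for g and h the functions of
    indices n + 1 and n. *)
Lemma log_coef_rec (K : numFieldType) n k :
  k.+1%:R * log_coef K n.+1 k.+1 = k%:R * log_coef K n.+1 k + log_coef K n k.
Proof.
rewrite /= mulVKf ?pnatr_eq0 // big_ord_recr /=; congr (_ + _).
by case: k => [|k]; [rewrite big_ord0 mul0r|rewrite mulVKf ?pnatr_eq0].
Qed.

Lemma log_coef_ge0 (K : numFieldType) n k : 0 <= log_coef K n k.
Proof.
elim: n k => [|n IH] [|k] //=; rewrite mulr_ge0 ?invr_ge0 // sumr_ge0 // => j _.
Qed.

Lemma log_coef_rmorph (K L : fieldType) (f : {rmorphism K -> L}) n k : f (log_coef K n k) = log_coef L n k.
Proof.
elim: n k => [|n IH] [|k] /=; rewrite ?rmorph0 ?rmorph1 //.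
by rewrite rmorphM fmorphV rmorph_nat rmorph_sum; congr (_ * _); apply: eq_bigr => j _.
Qed.

(** The coefficient of z^k in F(-log(1-z)), where F is the exponential
    generating function of e. The sum stops at k because (-log(1-z))^n is
    divisible by z^n. *)
Definition log_subst (K : fieldType) (e : nat -> K) k : K := \sum_(n < k.+1) e n * log_coef K n k.

(** The chain rule: if G(z) = F(-log(1-z)) then (1 - z) G'(z) = F'(-log(1-z)).
    *)
Lemma log_subst_rec (K : numFieldType) (e : nat -> K) k :
  k.+1%:R * log_subst e k.+1 = k%:R * log_subst e k + log_subst (fun n => e n.+1) k.
Proof.
have E0 m : m%:R * (e 0%N * log_coef K 0 m) = 0 by case: m => [|m] /=; rewrite ?mul0r // !mulr0.
rewrite /log_subst big_ord_recl mulrDr E0 add0r.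
have -> : k%:R * (\sum_(n < k.+1) e n * log_coef K n k) = k%:R * (\sum_(n < k.+1) e n.+1 * log_coef K n.+1 k).
  rewrite [in LHS]big_ord_recl mulrDr E0 add0r [in RHS]big_ord_recr.
  by rewrite [X in _ = _ * (_ + X)]mulrC log_coef_small // mul0r addr0.
rewrite !mulr_sumr -big_split; apply: eq_bigr => n _.
by rewrite lift0 mulrCA log_coef_rec mulrDr mulrCA.
Qed.

Section Powers.
Variables (K : numFieldType) (e : nat -> nat -> K).
Hypotheses (e00 : e 0%N 0%N = 1) (e0S : forall n, e 0%N n.+1 = 0).
Hypotheses (eS0 : forall N, e N.+1 0%N = 0).
Hypothesis eSS : forall N n, e N.+1 n.+1 = N.+1%:R * (e N n - e N.+1 n).

Lemma powers_small N n : (n < N)%N -> e N n = 0.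
Proof.
elim: n N => [|n IH] [|N] // nN; rewrite eSS !IH ?subr0 ?mulr0 //.
exact: ltnW.
Qed.

(** The hypotheses say that the rows of e are the powers of a solution of u' =
    1 - u with u(0) = 0, which is 1 - exp(-t); the substitution t = -log(1-z)
    turns it into z. *)
Lemma log_subst_powers N k : log_subst (e N) k = (N == k)%:R.
Proof.
elim: k N => [|k IH] N.
  by rewrite /log_subst big_ord1 /= mulr1; case: N.
have k0 : k.+1%:R != 0 :> K by rewrite pnatr_eq0.
apply: (mulfI k0); rewrite log_subst_rec IH.
case: N => [|N].
  rewrite /log_subst big1 => [|n _]; last by rewrite e0S mul0r.
  by case: k {IH k0} => [|k]; rewrite ?mul0r ?mulr0 ?addr0.
have -> : log_subst (fun n => e N.+1 n.+1) k = N.+1%:R * (log_subst (e N) k - log_subst (e N.+1) k).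
  rewrite /log_subst -sumrB mulr_sumr; apply: eq_bigr => n _.
  by rewrite eSS -mulrA mulrBl.
rewrite !IH eqSS; have [->|Nk] := eqVneq N k; first by rewrite gtn_eqF // mulr0 add0r subr0.
have [->|NSk] /= := eqVneq N.+1 k; first by rewrite mulr1 sub0r mulrN1 mulr0 subrr.
by rewrite !mulr0 subrr mulr0 addr0.
Qed.

End Powers.

Section PowersBound.
Variables (K : numFieldType) (E : nat -> nat -> K).
Hypotheses (E00 : E 0%N 0%N = 1) (E0S : forall n, E 0%N n.+1 = 0).
Hypotheses (ES0 : forall N, E N.+1 0%N = 0).
Hypothesis ESS : forall N n, E N.+1 n.+1 <= N.+1%:R * (E N n + E N.+1 n).

(** The extremal case is the powers of exp(t) - 1, which become the powers of
    z / (1-z); their coefficients are themselves at most the binomial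
    coefficients of the statement, which satisfy the recurrence with room to
    spare. *)
Lemma log_subst_le N k : log_subst (E N) k <= 'C(k, N)%:R.
Proof.
elim: k N => [|k IH] N.
  by rewrite /log_subst big_ord1 /= mulr1; case: N => [|N]; rewrite ?E00 ?ES0.
have k0 : 0 < k.+1%:R :> K by rewrite ltr0n.
rewrite -(ler_pM2l k0) log_subst_rec; case: N => [|N].
  rewrite [X in _ + X]/log_subst big1 ?addr0 => [|n _]; last by rewrite E0S mul0r.
  apply: le_trans (ler_wpM2l _ (IH 0%N)) _ => //.
  by rewrite !bin0 !mulr1 ler_nat.
have h : log_subst (fun n => E N.+1 n.+1) k <= N.+1%:R * (log_subst (E N) k + log_subst (E N.+1) k).
  rewrite /log_subst -big_split mulr_sumr; apply: ler_sum => n _ /=.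
  by rewrite -mulrDl mulrA ler_wpM2r ?log_coef_ge0.
apply: le_trans (_ : k%:R * 'C(k, N.+1)%:R + N.+1%:R * ('C(k, N)%:R + 'C(k, N.+1)%:R) <= _).
  apply: lerD; first by rewrite ler_wpM2l.
  by apply: le_trans h _; rewrite ler_wpM2l // lerD.
rewrite -natrD -!natrM -natrD ler_nat [('C(k, N) + _)%N]addnC -binS -mul_bin_diag.
by rewrite -pred_Sn binS mulnDr leq_add // leq_mul.
Qed.

End PowersBound.
End Stirling.

(** * Shuffle powers of -(-x_1)^+ *)

Section Shuffle.
Variable R : realType.
Local Notation C := (Cplx R).
Implicit Types (S T : ncseries R letterX) (w : seq letterX) (n N p q : nat).

Definition x1pow n : seq letterX := nseq n x1.

Lemma x1pow_inj : injective x1pow.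
Proof. by move=> m n /(congr1 size); rewrite !size_nseq. Qed.

Lemma only_x1_x1pow S w : only_x1 S -> S w != 0 -> w = x1pow (size w).
Proof. by move=> S1 /S1/all_pred1P. Qed.

(** Pascal's rule again: the two kinds of shuffles are told apart by the
    origin of the first letter. *)
Lemma shuffle_x1pow p q : shuffle_words (x1pow p) (x1pow q) = nseq 'C(p + q, p) (x1pow (p + q)).
Proof.
elim: p q => [|p IHp] q; first by rewrite bin0.
elim: q => [|q IHq]; first by rewrite addn0 binn.
rewrite -[LHS]/([seq x1 :: w | w <- shuffle_words (x1pow p) (x1pow q.+1)]
  ++ [seq x1 :: w | w <- shuffle_words (x1pow p.+1) (x1pow q)]).
rewrite IHp IHq !map_nseq [(p.+1 + q.+1)%N]addSn [(p.+1 + q)%N]addSnnS.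
by rewrite cat_nseq binS [('C(_, _) + _)%N]addnC [RHS]/nseq /ncons iterD.
Qed.

(** A pair of words contributes to the coefficient of a power of x_1 only if
    both are powers of x_1 with the right total length. *)
Lemma shuffle_prod_x1pow S T n : only_x1 S -> only_x1 T ->
  shuffle_prod S T (x1pow n) = bconv (fun i => S (x1pow i)) (fun i => T (x1pow i)) n.
Proof.
move=> S1 T1; rewrite /shuffle_prod.
pose h i := (x1pow i, x1pow (n - i)).
rewrite -(fsbig_widen (h @` `I_n.+1)) //; last first.
  move=> [u v] [_ /= nh]; apply/eqP; rewrite -[_ == _]negbK; apply/negP.
  rewrite !mulf_eq0 !negb_or -andbA => /and3P[Su Tv cuv].
  move: (only_x1_x1pow S1 Su) (only_x1_x1pow T1 Tv) => uE vE.
  rewrite uE vE shuffle_x1pow count_nseq /= in cuv.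
  have [nE|nE] := eqVneq (x1pow (size u + size v)) (x1pow n); last first.
    by rewrite (negPf nE) mul0n eqxx in cuv.
  have {}nE := x1pow_inj nE; apply: nh; exists (size u); first by rewrite /= ltnS -nE leq_addr.
  by rewrite /h -nE addKn -uE -vE.
rewrite fsbig_image; last by move=> i j _ _ [/x1pow_inj].
rewrite -fsbig_ord /bconv; apply: eq_bigr => i _.
have iN : (i <= n)%N by rewrite -ltnS.
by rewrite /h /= shuffle_x1pow count_nseq (subnKC iN) /= eqxx mul1n [LHS]mulrC.
Qed.

Lemma shuffle_prod_only_x1 S T : only_x1 S -> only_x1 T -> only_x1 (shuffle_prod S T).
Proof.
move=> S1 T1 w; apply: contraNT => wx; apply/eqP; apply: fsbig1 => -[u v] _ /=.
apply/eqP; rewrite -[_ == _]negbK; apply/negP.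
rewrite !mulf_eq0 !negb_or -andbA => /and3P[Su Tv cuv].
move: (only_x1_x1pow S1 Su) (only_x1_x1pow T1 Tv) => uE vE.
rewrite uE vE shuffle_x1pow count_nseq /= in cuv.
have [wE|wE] := eqVneq (x1pow (size u + size v)) w.
  by move: wx; rewrite -wE all_nseq /= orbT.
by rewrite (negPf wE) mul0n eqxx in cuv.
Qed.

(** In the product with -x_1 on the left, only the cut after the first letter
    contributes. *)
Lemma concat_pow_minus_x1 n w : concat_pow (@minus_x1 R) n w = (-1) ^+ n * (w == x1pow n)%:R.
Proof.
elim: n w => [|n IH] w; first by rewrite expr0 mul1r.
rewrite /concat_pow /= /concat_prod.
case: w => [|a w].
  by rewrite big_ord1 /= /minus_x1 /= oppr0 mul0r mulr0.
rewrite big_ord_recl /= {1}/minus_x1 /= oppr0 mul0r add0r big_ord_recl /= take0 drop0.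
rewrite big1 ?addr0 => [|i _]; last first.
  by rewrite /minus_x1; case: w i => [|b w] [i il] //=; rewrite eqseq_cons andbF oppr0 mul0r.
rewrite -/(concat_pow _ n) IH /minus_x1 /x1pow /= !eqseq_cons eqxx andbT exprS mulrA.
by case: (a == x1); rewrite /= ?oppr0 ?mul0r ?mulr0 // mulN1r.
Qed.

Lemma base1_only_x1 : only_x1 (base1 R).
Proof.
move=> w; apply: contraNT => wx; rewrite /base1 /plus_closure fsbig1 ?oppr0 // => n _.
rewrite concat_pow_minus_x1; case: eqVneq => [wE|_]; last by rewrite mulr0.
by move: wx; rewrite wE all_nseq /= orbT.
Qed.

Lemma base1_0 : base1 R (x1pow 0) = 0.
Proof.
rewrite /base1 /plus_closure fsbig1 ?oppr0 // => -[//|n _].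
by rewrite concat_pow_minus_x1 mulr0.
Qed.

Lemma base1_S n : base1 R (x1pow n.+1) = (-1) ^+ n.
Proof.
rewrite /base1 /plus_closure -(fsbig_widen [set n.+1] [set n | (0 < n)%N]) //.
- by rewrite fsbig_set1 concat_pow_minus_x1 eqxx mulr1 exprS mulN1r opprK.
- by move=> _ ->.
- move=> m [_ mn]; rewrite /= concat_pow_minus_x1; case: eqVneq => [E|_]; last by rewrite mulr0.
  by case: mn; exact/esym/x1pow_inj.
Qed.

Definition shuffle_pow_coef N n : C := shuffle_pow (base1 R) N (x1pow n).

Lemma shuffle_pow_only_x1 N : only_x1 (shuffle_pow (base1 R) N).
Proof.
elim: N => [|N IH]; last by apply: shuffle_prod_only_x1 => //; exact: base1_only_x1.
by move=> w; rewrite /shuffle_pow /= /empty_word; case: (eqVneq w [::]) => [-> //|_]; rewrite eqxx.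
Qed.

Lemma shuffle_pow_coef0 n : shuffle_pow_coef 0 n = (n == 0%N)%:R.
Proof. by rewrite /shuffle_pow_coef /shuffle_pow /= /empty_word; case: n. Qed.

Lemma shuffle_pow_coefS N n : shuffle_pow_coef N.+1 n = bconv (fun i => base1 R (x1pow i)) (shuffle_pow_coef N) n.
Proof. by rewrite /shuffle_pow_coef -shuffle_prod_x1pow //; [exact: base1_only_x1|exact: shuffle_pow_only_x1]. Qed.

Lemma shuffle_pow_coefS0 N : shuffle_pow_coef N.+1 0 = 0.
Proof. by rewrite shuffle_pow_coefS /bconv big_ord1 base1_0 mul0r mulr0. Qed.

(** The derivation rule for the powers of u = 1 - exp(-t), the generating
    function of base1: by Leibniz, the derivative of u^(N+1) is (N+1) (u^N -
    u^(N+1)). *)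
Lemma shuffle_pow_coefSS N n : shuffle_pow_coef N.+1 n.+1 = N.+1%:R * (shuffle_pow_coef N n - shuffle_pow_coef N.+1 n).
Proof.
(* The relation u' = 1 - u, multiplied by a power of u. *)
have D m K : bconv (fun i => base1 R (x1pow i.+1)) (shuffle_pow_coef K) m = shuffle_pow_coef K m - shuffle_pow_coef K.+1 m.
  have -> : (fun i => base1 R (x1pow i.+1)) = (fun i => (i == 0%N)%:R - base1 R (x1pow i)).
    apply/funext => -[|i]; rewrite base1_S ?base1_0 ?subr0 // base1_S sub0r exprS mulN1r //.
  have E : shuffle_pow_coef K m = \sum_(i < m.+1) 'C(m, i)%:R * ((i == 0%N :> nat)%:R * shuffle_pow_coef K (m - i)).
    rewrite big_ord_recl /= bin0 subn0 !mul1r big1 ?addr0 // => i _.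
    by rewrite mul0r mulr0.
  rewrite [X in _ = X - _]E shuffle_pow_coefS /bconv -sumrB; apply: eq_bigr => i _.
  by rewrite mulrBl mulrBr.
elim: N n => [|N IH] n.
  rewrite shuffle_pow_coefS bconv_leibniz D mul1r; rewrite [X in _ + X](_ : _ = 0) ?addr0 //.
  by rewrite /bconv big1 // => i _; rewrite shuffle_pow_coef0 !mulr0.
rewrite shuffle_pow_coefS bconv_leibniz D.
have -> : bconv (fun i => base1 R (x1pow i)) (fun i => shuffle_pow_coef N.+1 i.+1) n =
    N.+1%:R * (shuffle_pow_coef N.+1 n - shuffle_pow_coef N.+2 n).
  rewrite (shuffle_pow_coefS N) (shuffle_pow_coefS N.+1) /bconv -sumrB mulr_sumr; apply: eq_bigr => i _.
  by rewrite IH; ring.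
by rewrite -[in RHS]natr1; ring.
Qed.

End Shuffle.

(** * Taylor series as values of Li *)

Section TaylorSeries.
Variable R : realType.
Local Notation C := (Cplx R).
Implicit Types (S : ncseries R letterX) (n N k : nat).

Definition y1 : letterY := exist (fun n => (0 < n)%N) 1%N isT.

Lemma encode_nseq_y1 n : encode (nseq n y1) = x1pow n.
Proof. by elim: n => //= n IH; rewrite encode_cons IH. Qed.

(** Both sides obey the same recurrence: the polylogarithm of the n-th power
    of x_1 is (-log(1-z))^n / n!. *)
Lemma Li_coef_y1 n k : Li_word_coef R (nseq n y1) k = log_coef R[i] n k.
Proof.
elim: n k => [|n IH] k; first by rewrite Li_word_coef_nil.
case: k => [|k]; first exact: Li_word_coef_cons0.
rewrite Li_word_coef_consS H_wordE expr1 /cumul [RHS]/=; congr (_ * _).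
by apply: eq_bigr => j _.
Qed.

(** The only word of length n in the support is the n-th power of x_1. *)
Lemma Li_poly_coef_only_x1 S n k : only_x1 S ->
  Li_poly_coef (length_part n S) k = S (x1pow n) * log_coef R[i] n k.
Proof.
move=> S1; rewrite /Li_poly_coef -(fsbig_widen [set nseq n y1]) //.
  by rewrite fsbig_set1 Li_coef_y1 encode_nseq_y1 /length_part size_nseq eqxx.
move=> v [_ /= vn]; rewrite /length_part; case: eqVneq => [sv|_]; last by rewrite mul0r.
have [->|Sv] := eqVneq (S (encode v)) 0; first by rewrite mul0r.
case: vn; apply: encode_inj; rewrite encode_nseq_y1 -sv.
exact: only_x1_x1pow S1 Sv.
Qed.

(** The supremum of some tail of the sequence is below B'; the finitely many
    remaining terms are absorbed in A. *)
Lemma root_test (a : nat -> C) (B B' : R) :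
  limn_esup (fun N => (cabs (a N) `^ (N%:R^-1))%:E) = B%:E -> B < B' -> 0 < B' ->
  exists2 A, 0 <= A & forall N, cabs (a N) <= A * B' ^+ N.
Proof.
move=> aB BB' B'0.
have : (ereal_inf [set ereal_sup ((fun N => (cabs (a N) `^ (N%:R^-1))%:E) @` X) | X in \oo] < B'%:E)%E.
  by rewrite -[X in (X < _)%E]/(limn_esup _) aB lte_fin.
move=> /ereal_inf_lt[_ [X [n0 _ n0X] <-] supX].
have bnd N : (n0 <= N)%N -> (0 < N)%N -> cabs (a N) <= B' ^+ N.
  move=> nN N0.
  have le1 : cabs (a N) `^ (N%:R^-1) <= B'.
    rewrite -lee_fin; apply: le_trans (ltW supX); apply: ereal_sup_ubound.
    by exists N => //; exact: n0X.
  have -> : cabs (a N) = (cabs (a N) `^ (N%:R^-1)) ^+ N.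
    by rewrite -powR_mulrn ?powR_ge0 // -powRrM mulVf ?powRr1 ?cabs_ge0 // pnatr_eq0 -lt0n.
  by rewrite lerXn2r ?nnegrE ?powR_ge0 // ltW.
pose s := \sum_(k < n0.+1) cabs (a k) / B' ^+ k.
have t0 k : 0 <= cabs (a k) / B' ^+ k by rewrite divr_ge0 ?cabs_ge0 // exprn_ge0 // ltW.
have s0 : 0 <= s by apply: sumr_ge0.
exists (1 + s) => [|N]; first by rewrite addr_ge0.
have [Nn0|n0N] := leqP N n0.
  rewrite -ler_pdivrMr ?exprn_gt0 // /s (bigD1 (Ordinal (Nn0 : (N < n0.+1)%N))) //= addrCA lerDl.
  by rewrite addr_ge0 // sumr_ge0.
apply: le_trans (bnd N _ _) _; [exact: ltnW|exact: leq_ltn_trans n0N|].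
by rewrite ler_peMl ?lerDl // exprn_ge0 // ltW.
Qed.

Lemma limn_esup_ge0 (u : nat -> R) (B : R) : (forall n, 0 <= u n) ->
  limn_esup (fun N => (u N)%:E) = B%:E -> 0 <= B.
Proof.
move=> u0 uB; rewrite leNgt; apply/negP => B0.
have : (ereal_inf [set ereal_sup ((fun N => (u N)%:E) @` X) | X in \oo] < 0%:E)%E.
  by rewrite -[X in (X < _)%E]/(limn_esup _) uB lte_fin.
move=> /ereal_inf_lt[_ [X [n0 _ n0X] <-] supX].
have : ((u n0)%:E <= ereal_sup ((fun N => (u N)%:E) @` X))%E.
  by apply: ereal_sup_ubound; exists n0 => //; apply: n0X => /=.
by move=> /le_lt_trans/(_ supX); rewrite lte_fin ltNge u0.
Qed.

Lemma csum_finite (u : nat -> C) m : (forall n, (m <= n)%N -> u n = 0) ->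
  csum u = \sum_(n < m) u n.
Proof.
move=> um; apply: cvg_csum; apply/cvg_cabsP => e e0; exists m => // n /= mn.
rewrite seriesE cabsB (sum_ord_sub u mn) big_nat_cond big1 ?cabs0 // => i.
by rewrite andbT => /andP[/um].
Qed.

Variables (a : nat -> C) (B : R).
Hypothesis aB : limn_esup (fun N => (cabs (a N) `^ (N%:R^-1))%:E) = B%:E.

Let F N w := a N * shuffle_pow (base1 R) N w.
Let S := sum_family F.

Let shuffle_pow_coef_small N n : (n < N)%N -> shuffle_pow_coef R N n = 0.
Proof.
apply: powers_small => *; [by rewrite shuffle_pow_coef0|exact: shuffle_pow_coefS0|exact: shuffle_pow_coefSS].
Qed.

Lemma log_subst_shuffle_pow_coef N k : log_subst (shuffle_pow_coef R N : nat -> R[i]) k = (N == k)%:R.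
Proof.
apply: log_subst_powers => *; [by rewrite shuffle_pow_coef0|by rewrite shuffle_pow_coef0|exact: shuffle_pow_coefS0|exact: shuffle_pow_coefSS].
Qed.

(** The N-th shuffle power starts at length N since base1 has no constant
    term; hence only finitely many N contribute to a given word. *)
Lemma term_support w N : F N w != 0 -> w = x1pow (size w) /\ (N <= size w)%N.
Proof.
rewrite /F mulf_eq0 negb_or => /andP[_ sw].
have wE := only_x1_x1pow (@shuffle_pow_only_x1 R N) sw; split=> //.
rewrite leqNgt; apply/negP => /shuffle_pow_coef_small; rewrite /shuffle_pow_coef -wE => E.
by rewrite E eqxx in sw.
Qed.

Lemma terms_summable : summable_family F.
Proof.
move=> w; apply: (@sub_finite_set _ _ `I_(size w).+1) => // N /= /term_support[_].
by rewrite ltnS.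
Qed.

Lemma sum_only_x1 : only_x1 S.
Proof.
move=> w; apply: contraNT => wx; apply/eqP; apply: fsbig1 => N _.
apply/eqP; rewrite -[_ == _]negbK; apply/negP => /term_support[wE _].
by move: wx; rewrite wE all_nseq /= orbT.
Qed.

Lemma sum_ends_in_x1 : ends_in_x1 S.
Proof.
move=> w /sum_only_x1; case/lastP: w => [|u x]; first by left.
by rewrite all_rcons => /andP[/eqP -> _]; right; exists u.
Qed.

Lemma sum_coef_x1pow n k : (n <= k)%N -> S (x1pow n) = \sum_(N < k.+1) a N * shuffle_pow_coef R N n.
Proof.
move=> nk; rewrite /S /sum_family -(fsbig_widen `I_k.+1) //; first by rewrite -fsbig_ord.
move=> N [_ /= /negP]; rewrite -leqNgt => kN.
by rewrite /F -/(shuffle_pow_coef R N n) shuffle_pow_coef_small ?mulr0 //; exact: leq_trans kN.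
Qed.

Let c n := Li_poly_coef (length_part n S).

Lemma Li_coef_small n k : (k < n)%N -> c n k = 0.
Proof. by move=> kn; rewrite /c (Li_poly_coef_only_x1 _ _ sum_only_x1) log_coef_small ?mulr0. Qed.

(** The N-th shuffle power contributes z^N, by log_subst_powers, so summing
    over n at fixed k leaves a_k. *)
Lemma Li_coef_column k : csum (fun n => c n k) = a k.
Proof.
rewrite (csum_finite (m := k.+1)); last by move=> n; exact: Li_coef_small.
transitivity (\sum_(N < k.+1) a N * log_subst (shuffle_pow_coef R N : nat -> R[i]) k).
  under [RHS]eq_bigr do rewrite /log_subst mulr_sumr.
  rewrite exchange_big; apply: eq_bigr => n _.
  rewrite /c (Li_poly_coef_only_x1 _ _ sum_only_x1) (@sum_coef_x1pow n k) -1?ltnS // mulr_suml.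
  by apply: eq_bigr => N _; rewrite mulrA.
rewrite big_ord_recr /= big1 ?add0r => [|N _]; last first.
  by rewrite log_subst_shuffle_pow_coef (ltn_eqF (ltn_ord N)) mulr0.
by rewrite log_subst_shuffle_pow_coef eqxx mulr1.
Qed.

(** Taking absolute values termwise, log_subst_le leaves the sum of A B'^N
    times a binomial coefficient, which is the expansion of A (1 + B')^k. *)
Lemma Li_coef_column_bound k n B' A : (forall N, cabs (a N) <= A * B' ^+ N) ->
  \sum_(i < n) cabs (c i k) <= A * (1 + B') ^+ k.
Proof.
move=> aA.
apply: (@le_trans _ _ (\sum_(i < k.+1) cabs (c i k))).
  have [nk|kn] := leqP n k.+1; first exact: (abs_sum_mono (fun i => c i k)).
  rewrite -subr_le0 (sum_ord_sub (fun i => cabs (c i k)) (ltnW kn)) big_nat_cond big1 // => i.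
  by rewrite andbT => /andP[ki _]; rewrite Li_coef_small ?cabs0.
pose E N i := cabs (shuffle_pow_coef R N i).
have coefE i : cabs (log_coef R[i] i k : C) = log_coef R i k.
  by rewrite -(log_coef_rmorph (real_complex R)) cabs_realge0 // log_coef_ge0.
apply: (@le_trans _ _ (\sum_(N < k.+1) cabs (a N) * log_subst (E N) k)).
  under [leRHS]eq_bigr do rewrite /log_subst mulr_sumr.
  rewrite exchange_big; apply: ler_sum => i _.
  rewrite /c (Li_poly_coef_only_x1 _ _ sum_only_x1) (@sum_coef_x1pow i k) -1?ltnS // cabsM coefE.
  under eq_bigr do rewrite mulrA; rewrite -mulr_suml ler_wpM2r ?log_coef_ge0 //.
  apply: le_trans (cabs_sum _ _ _) _; apply: ler_sum => N _; by rewrite cabsM.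
have EC N : log_subst (E N) k <= 'C(k, N)%:R.
  apply: log_subst_le => *; rewrite /E ?shuffle_pow_coef0 ?shuffle_pow_coefS0 ?shuffle_pow_coefSS ?cabs0 ?cabs1 //.
  rewrite cabsM cabs_nat ler_wpM2l //; apply: le_trans (cabsD _ _) _.
  by rewrite cabsN.
rewrite exprDn mulr_sumr; apply: ler_sum => N _.
rewrite expr1n mul1r -mulr_natr mulrA.
by apply: ler_pM => //; [exact: cabs_ge0|apply: sumr_ge0 => i _; rewrite mulr_ge0 ?log_coef_ge0 ?cabs_ge0].
Qed.

Let B0 : 0 <= B.
Proof. by apply: limn_esup_ge0 aB => n; exact: powR_ge0. Qed.

Let rho := (B + 1)^-1.
Let rho0 : 0 < rho. Proof. by rewrite invr_gt0 ltr_wpDl. Qed.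
Let rho1 : rho <= 1. Proof. by rewrite invf_le1 ?ltr_wpDl // lerDr. Qed.

(** The condition r < 1 / (B + 1) is exactly what leaves room for B' between B
    and 1 / r - 1; B' is the midpoint. *)
Lemma larger_base r : 0 < r -> r < rho -> exists B', [/\ B < B', 0 < B' & r * (1 + B') < 1].
Proof.
move=> r0 rrho; have h : B + 1 < r^-1.
  by rewrite -[X in X < _]invrK ltf_pV2 ?posrE.
exists ((B + (r^-1 - 1)) / 2); have := B0; split; [by move: h; lra|by move: h; lra|].
rewrite -ltr_pdivlMl // mulr1; by move: h; lra.
Qed.

Lemma Li_coef_rect r : 0 < r -> r < rho -> exists M, rect_bounded (fun n k => c n k * r%:C%C ^+ k) M.
Proof.
move=> r0 rrho; have [B' [BB' B'0 rB']] := larger_base r0 rrho.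
have [A A0 aA] := root_test aB BB' B'0.
have q0 : 0 <= r * (1 + B') by rewrite mulr_ge0 ?addr_ge0 // ltW.
exists (A * (1 - r * (1 + B'))^-1) => n m; rewrite -rect_swap /rect.
apply: (@le_trans _ _ (A * \sum_(k < m) (r * (1 + B')) ^+ k)); last first.
  by rewrite ler_wpM2l // geometric_sum_le.
rewrite mulr_sumr; apply: ler_sum => k _.
under eq_bigr do rewrite cabsM cabsX cabs_realge0 ?(ltW r0) //.
rewrite -mulr_suml exprMn [r ^+ k * _]mulrC mulrA ler_wpM2r ?exprn_ge0 ?(ltW r0) //.
exact: Li_coef_column_bound.
Qed.

Lemma taylor_series_is_Li :
  [/\ summable_family F, only_x1 S, Dom_Li rho S &
     forall z : C, cabs z < rho ->
          series (fun N => a N * z ^+ N) @ \oo --> (Li_series S z : C)].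
Proof.
have LE n z : cabs z < rho -> Li_poly (length_part n S) z = psum (c n) z.
  move=> zr; apply: (@Li_polyE _ n); first exact: length_part_size.
  exact: lt_le_trans rho1.
split; [exact: terms_summable|exact: sum_only_x1| |].
  by split; [exact: sum_ends_in_x1|exact: (unconditional_of_rect_bounded rho0 LE Li_coef_rect)].
move=> z zrho; pose r := (cabs z + rho) / 2; have z0 := cabs_ge0 z.
have [r0 zr rrho] : [/\ 0 < r, cabs z <= r & r < rho].
  by move: rho0; rewrite /r; split; lra.
have [M cM] := Li_coef_rect r0 rrho.
have -> : series (fun N => a N * z ^+ N) =
    series (fun N => csum (fun n => c n N) * z ^+ N).
  by congr series; apply/funext => N; rewrite Li_coef_column.
have -> : Li_series S z = psum (fun N => csum (fun n => c n N)) z.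
  rewrite -(cvg_csum (psum_exchange r0 zr cM)); congr csum.
  by apply/funext => n; exact: LE.
exact: abs_bounded_cvg (columns_bounded r0 zr cM).
Qed.

End TaylorSeries.

Theorem theorem2p6 (R : realType) :
  (forall (a : nat -> Cplx R) (B : R),
    limn_esup (fun N => (cabs (a N) `^ (N%:R^-1))%:E) = B%:E ->
    let F := fun N w => a N * shuffle_pow (base1 R) N w in
    let S := sum_family F in
    [/\ summable_family F,
        only_x1 S,
        Dom_Li (B + 1)^-1 S &
        forall z : Cplx R, cabs z < (B + 1)^-1 ->
          series (fun N => a N * z ^+ N) @ \oo --> (Li_series S z : Cplx R)])
  /\
  (forall (rho : R) (S : ncseries R letterX),
    0 < rho -> rho <= 1 -> Dom_Li rho S ->
    (exists! h : nat -> Cplx R, is_H_of_series rho S h) /\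
    (forall h : nat -> Cplx R, is_H_of_series rho S h ->
      (forall r : R, 0 < r -> r < rho ->
        (\esum_(p in [set: nat * nat])
          (cabs (H_poly (piY (length_part p.1 S)) p.2 * r%:C%C ^+ p.2))%:E < +oo)%E) /\
      (forall N : nat,
        (\esum_(n in [set: nat])
          (cabs (H_poly (piY (length_part n S)) N))%:E < +oo)%E /\
        series (fun n => H_poly (piY (length_part n S)) N) @ \oo --> h N)))
  /\
  (forall (Q : ncseries R letterY) (r : R),
    0 < r -> r <= 1 ->
    (\esum_(p in [set: nat * nat])
      (cabs (H_poly (weight_part p.1 Q) p.2 * r%:C%C ^+ p.2))%:E < +oo)%E ->
    exists l : nat -> Cplx R,
      [/\ (forall N : nat,
             partial_sum (fun n => H_poly (weight_part n Q) N) @ totally --> l N),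
          Dom_Li r (piX Q),
          (forall z : Cplx R, cabs z < r ->
             series (fun N => l N * z ^+ N) @ \oo -->
               (Li_series (piX Q) z / (1 - z) : Cplx R)) &
          (* up to the boundary, through the Taylor series of Li_{pi_X(Q_n)} *)
          (forall z : Cplx R, cabs z <= r -> z != 1 ->
             exists (L : nat -> Cplx R) (Lsum : Cplx R),
               [/\ (forall n : nat,
                      series (fun N => Li_poly_coef (piX (weight_part n Q)) N * z ^+ N)
                        @ \oo --> L n),
                   series L @ \oo --> Lsum &
                   series (fun N => l N * z ^+ N) @ \oo --> (Lsum / (1 - z) : Cplx R)])]).
Proof.
split; last split.
- by move=> a B aB; exact: taylor_series_is_Li.
- by move=> rho S rho0 rho1 domS; exact: Dom_Li_harmonic_sums.
- by move=> Q r r0 r1 hQ; exact: harmonic_sums_Dom_Li.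
Qed.
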